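(* Let $(\lambda_n)_{n\ge0}$ be an increasing sequence of non-negative real numbers tending to infinity, let $(c_n)_{n\ge0}$ be complex numbers, and suppose $$\sum_{\lambda_n\le x}\lambda_n|c_n|=O(x)\quad(x\to\infty).$$ Let $\ell\in\mathbb{C}$. Then the following six statements are equivalent. The series $\sum_{n=0}^\infty c_n$ is: (a) $(\mathrm{L},\{\lambda_n\})$ summable to $\ell$; (b) $(\gamma,\{\lambda_n\},\kappa)$ summable to $\ell$ for some $\kappa\ge1$; (c) $(\gamma,\{\lambda_n\},\kappa)$ summable to $\ell$ for all $\kappa\ge1$; (d) $(\mathrm{R},\{\lambda_n\},\beta)$ summable to $\ell$ for some $\beta>0$; (e) $(\mathrm{R},\{\lambda_n\},\beta)$ summable to $\ell$ for all $\beta>0$; (f) $(\mathrm{A},\{\lambda_n\})$ summable to $\ell$.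
   Context: Riesz summability: $\sum c_n=\ell$ $(\mathrm{R},\{\lambda_n\},\beta)$ means $\lim_{x\to\infty}\sum_{\lambda_n\le x}c_n(1-\lambda_n/x)^\beta=\ell$. Abel-type summability: $\sum c_n=\ell$ $(\mathrm{A},\{\lambda_n\})$ means $\sum_n c_ne^{-\lambda_ny}$ converges for every $y>0$ and tends to $\ell$ as $y\to0^+$. Young functions: for $\kappa>0$, $\gamma_\kappa(x)=\frac{\kappa}{x}\int_0^x(1-t/x)^{\kappa-1}\cos t\,dt$ (with $\gamma_\kappa(0)=1$). $\sum c_n=\ell$ $(\gamma,\{\lambda_n\},\kappa)$ means $\sum_n c_n\gamma_\kappa(\lambda_nh)$ converges for all sufficiently small $h>0$ and tends to $\ell$ as $h\to0^+$. $\sum c_n=\ell$ $(\mathrm{L},\{\lambda_n\})$ means $\sum c_n=\ell$ $(\gamma,\{\lambda_n\},1)$ and additionally $\sum_{\lambda_n>0}c_n\frac{e^{i\lambda_nh}}{\lambda_nh}$ converges for all sufficiently small $|h|>0$. *)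

(* Defs.v *)
From Stdlib Require Import Reals.
From Coquelicot Require Import Coquelicot.
Open Scope R_scope.

(* real power b^e for b >= 0 (with 0^0 = 1, 0^e = 0 for e <> 0) *)
Definition pw (b e : R) : R :=
  if Rlt_dec 0 b then Rpower b e
  else if Req_EM_T e 0 then 1 else 0.

(* value of a complex series (componentwise); for a convergent (in particular
   an eventually zero) series this is its sum *)
Definition CSeries (a : nat -> C) : C :=
  (Series (fun n => Re (a n)), Series (fun n => Im (a n))).

(* finite sum over {n | lam n <= x} (finite since lam -> +oo) *)
Definition sum_le (lam : nat -> R) (f : nat -> C) (x : R) : C :=
  CSeries (fun n => if Rle_dec (lam n) x then f n else RtoC 0).

Definition sum_le_R (lam : nat -> R) (f : nat -> R) (x : R) : R :=
  Series (fun n => if Rle_dec (lam n) x then f n else 0).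

Definition Riesz_summable (lam : nat -> R) (c : nat -> C) (beta : R) (l : C) : Prop :=
  filterlim (fun x => sum_le lam (fun n => (c n * RtoC (pw (1 - lam n / x) beta))%C) x)
    (Rbar_locally p_infty) (locally l).

Definition Abel_summable (lam : nat -> R) (c : nat -> C) (l : C) : Prop :=
  (forall y, 0 < y -> ex_series (fun n => (c n * RtoC (exp (- (lam n * y))))%C)) /\
  filterlim (fun y => CSeries (fun n => (c n * RtoC (exp (- (lam n * y))))%C))
    (at_right 0) (locally l).

Definition young (kappa x : R) : R :=
  if Req_EM_T x 0 then 1
  else kappa / x * RInt (fun t => pw (1 - t / x) (kappa - 1) * cos t) 0 x.

Definition gamma_summable (lam : nat -> R) (c : nat -> C) (kappa : R) (l : C) : Prop :=
  (exists h0, 0 < h0 /\ forall h, 0 < h < h0 ->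
      ex_series (fun n => (c n * RtoC (young kappa (lam n * h)))%C)) /\
  filterlim (fun h => CSeries (fun n => (c n * RtoC (young kappa (lam n * h)))%C))
    (at_right 0) (locally l).

Definition cexpi (t : R) : C := (cos t, sin t).

Definition L_summable (lam : nat -> R) (c : nat -> C) (l : C) : Prop :=
  gamma_summable lam c 1 l /\
  (exists h0, 0 < h0 /\ forall h, 0 < Rabs h < h0 ->
      ex_series (fun n => if Rlt_dec 0 (lam n)
                          then (c n * cexpi (lam n * h) / RtoC (lam n * h))%C
                          else RtoC 0)).

(* Main.v *)
Require Import Defs.
From Stdlib Require Import Reals Lra Lia.
From Coquelicot Require Import Coquelicot.
Open Scope R_scope.

(** All five methods are limits, as [h -> 0+], of means [sum_n c_n phi (lam_n h)] for a real kernel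
    [phi] with [phi x = O (1 / (1 + x))] and [phi x - phi 0 = O (x)].  Summation by parts bounds
    [sum_n |c_n| w (lam_n h)], [w x = sqrt x / (1 + x)], uniformly in [h <= 1]; hence the kernels
    whose means tend to [phi 0 * l] are closed under linear combinations, dilations, and uniform
    limits along which the implied constants stay bounded.
    If [x psi' = p (phi - psi)], then [psi] is an average of dilations of [phi] and inherits this
    property from it.  This raises the order of a Riesz kernel or of a Young function by one, and as
    the order [k] grows [(1 - x / k)^k] tends to [exp (- x)] and [young k (k x)] to [1 / (1 + x^2)].
    Conversely, let [u] be one of these two limits.  All powers of [u] are obtained from [u], by
    dilation or by partial fractions, and every continuous kernel is a limit of Bernstein
    polynomials in [u]; the constants stay bounded because a Bernstein polynomial of a concave
    function lies below that function. *)

Lemma continuity_pt_of_is_derive (f : R -> R) (x d : R) :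
  is_derive f x d -> continuity_pt f x.
Proof.
  intros H. apply derivable_continuous_pt. exists d. now apply is_derive_Reals.
Qed.

Lemma continuity_of_is_derive (f df : R -> R) :
  (forall x, is_derive f x (df x)) -> continuity f.
Proof. intros H x. exact (continuity_pt_of_is_derive _ _ _ (H x)). Qed.

Lemma le_of_derive_ge0 (f df : R -> R) (a b : R) :
  a <= b ->
  (forall x, a <= x <= b -> continuity_pt f x) ->
  (forall x, a < x < b -> is_derive f x (df x)) ->
  (forall x, a <= x <= b -> 0 <= df x) ->
  f a <= f b.
Proof.
  intros Hab Cf Df Hdf.
  destruct (MVT_gen f a b df) as (x & Hx & E);
    rewrite ?Rmin_left, ?Rmax_right in * by exact Hab; auto.
  specialize (Hdf x Hx). nra.
Qed.

Lemma Rabs_diff_le_of_derive (f g df dg : R -> R) (a b : R) :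
  a <= b ->
  (forall x, a <= x <= b -> continuity_pt f x) ->
  (forall x, a <= x <= b -> continuity_pt g x) ->
  (forall x, a < x < b -> is_derive f x (df x)) ->
  (forall x, a < x < b -> is_derive g x (dg x)) ->
  (forall x, a <= x <= b -> Rabs (df x) <= dg x) ->
  Rabs (f b - f a) <= g b - g a.
Proof.
  intros Hab Cf Cg Df Dg Hd.
  assert (Hplus : g a + f a <= g b + f b).
  { apply (le_of_derive_ge0 (fun x => g x + f x) (fun x => dg x + df x) a b Hab).
    - intros x Hx. apply (continuity_pt_plus g f); auto.
    - intros x Hx. apply (is_derive_plus (V := R_NormedModule) g f); auto.
    - intros x Hx. pose proof (proj1 (Rabs_le_between _ _) (Hd x Hx)). lra. }
  assert (Hminus : g a - f a <= g b - f b).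
  { apply (le_of_derive_ge0 (fun x => g x - f x) (fun x => dg x - df x) a b Hab).
    - intros x Hx. apply (continuity_pt_minus g f); auto.
    - intros x Hx. apply (is_derive_minus (V := R_NormedModule) g f); auto.
    - intros x Hx. pose proof (proj1 (Rabs_le_between _ _) (Hd x Hx)). lra. }
  apply Rabs_le. lra.
Qed.

Lemma exp_le (x y : R) : x <= y -> exp x <= exp y.
Proof. intros [H| ->]; [left; now apply exp_increasing|right; reflexivity]. Qed.

Lemma exp_neg_bounds (x : R) : 0 <= x -> 0 < exp (- x) <= 1.
Proof.
  intros Hx. split; [apply exp_pos|]. rewrite <- exp_0. apply exp_le. lra.
Qed.

(** * Real powers *)

Lemma pw_Rpower (b e : R) : 0 < b -> pw b e = Rpower b e.
Proof. intros H. unfold pw. destruct (Rlt_dec 0 b); [reflexivity|lra]. Qed.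

Lemma pw_nonpos (b e : R) : b <= 0 -> e <> 0 -> pw b e = 0.
Proof.
  intros H He. unfold pw. destruct (Rlt_dec 0 b); [lra|].
  destruct (Req_EM_T e 0); [contradiction|reflexivity].
Qed.

Lemma pw_O (b : R) : pw b 0 = 1.
Proof.
  unfold pw. destruct (Rlt_dec 0 b); [now apply Rpower_O|].
  destruct (Req_EM_T 0 0); [reflexivity|lra].
Qed.

Lemma pw_pos (b e : R) : 0 < b -> 0 < pw b e.
Proof. intros H. rewrite pw_Rpower by exact H. apply exp_pos. Qed.

Lemma pw_ge0 (b e : R) : 0 <= pw b e.
Proof.
  unfold pw. destruct (Rlt_dec 0 b); [left; apply exp_pos|].
  destruct (Req_EM_T e 0); lra.
Qed.

Lemma pw_1_l (e : R) : pw 1 e = 1.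
Proof.
  rewrite pw_Rpower by lra. unfold Rpower. now rewrite ln_1, Rmult_0_r, exp_0.
Qed.

Lemma pw_mult (x y e : R) : 0 < y -> pw (x * y) e = pw x e * pw y e.
Proof.
  intros Hy. destruct (Rlt_dec 0 x) as [Hx|Hx].
  - rewrite !pw_Rpower by (try apply Rmult_lt_0_compat; assumption).
    symmetry. now apply Rpower_mult_distr.
  - destruct (Req_dec e 0) as [->|He].
    + rewrite !pw_O. ring.
    + rewrite (pw_nonpos x), (pw_nonpos (x * y)) by (auto; nra). ring.
Qed.

Lemma pw_pred (x e : R) : 0 <= x -> e <> 0 -> pw x e = x * pw x (e - 1).
Proof.
  intros [Hx|<-] He.
  - rewrite !pw_Rpower, <- (Rpower_1 x) at 1 by exact Hx.
    rewrite Rpower_mult, Rmult_1_l. rewrite <- (Rpower_1 x) at 2 by exact Hx.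
    rewrite <- Rpower_plus. f_equal. ring.
  - rewrite pw_nonpos by lra. ring.
Qed.

Lemma pw_le_l (x y e : R) : x <= y -> 0 <= e -> pw x e <= pw y e.
Proof.
  intros Hxy He. destruct (Rlt_dec 0 x) as [Hx|Hx].
  - rewrite !pw_Rpower by lra. apply Rle_Rpower_l; lra.
  - destruct (Req_dec e 0) as [->|He0].
    + rewrite !pw_O. lra.
    + rewrite (pw_nonpos x) by (auto; lra). apply pw_ge0.
Qed.

Lemma pw_le_1 (x e : R) : x <= 1 -> 0 <= e -> pw x e <= 1.
Proof. intros Hx He. rewrite <- (pw_1_l e). now apply pw_le_l. Qed.

Lemma pw_exp (x e : R) : pw (exp x) e = exp (e * x).
Proof. rewrite pw_Rpower by apply exp_pos. unfold Rpower. now rewrite ln_exp. Qed.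

Lemma continuity_pt_pw (x e : R) : 0 <= e -> continuity_pt (fun y => pw y e) x.
Proof.
  intros [He|<-].
  2:{ apply (continuity_pt_ext (fun _ => 1)); [intros y; now rewrite pw_O|].
      apply continuity_pt_const. now intros ? ?. }
  destruct (Rtotal_order x 0) as [Hx|[->|Hx]].
  - apply (continuity_pt_ext_loc (fun _ => 0)).
    + apply (filter_imp (fun y => y < 0)); [|exact (open_lt 0 x Hx)].
      intros y Hy. rewrite pw_nonpos; lra.
    + apply continuity_pt_const. now intros ? ?.
  - intros eps Heps. exists (Rpower eps (/ e)). split; [apply exp_pos|].
    intros y [_ Hy]. simpl in *. unfold R_dist in *.
    rewrite (pw_nonpos 0), Rminus_0_r, Rabs_pos_eq in * by (try apply pw_ge0; lra).
    apply Rle_lt_trans with (pw (Rabs y) e); [apply pw_le_l; [apply Rle_abs|lra]|].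
    destruct (Rabs_pos y) as [Hy0|<-]; [|rewrite pw_nonpos; lra].
    replace eps with (Rpower (Rpower eps (/ e)) e).
    + rewrite pw_Rpower by exact Hy0. apply Rlt_Rpower_l; lra.
    + rewrite Rpower_mult, Rinv_l by lra. now apply Rpower_1.
  - apply (continuity_pt_ext_loc (fun y => Rpower y e)).
    + apply (filter_imp (fun y => 0 < y)); [|exact (open_gt 0 x Hx)].
      intros y Hy. now rewrite pw_Rpower.
    + apply continuity_pt_of_is_derive with (e * Rpower x (e - 1)).
      now apply is_derive_Reals, derivable_pt_lim_power.
Qed.

Lemma is_derive_pw (x e : R) :
  0 < x \/ 1 < e -> is_derive (fun y => pw y e) x (e * pw x (e - 1)).
Proof.
  intros Hxe. destruct (Rtotal_order x 0) as [Hx|[->|Hx]].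
  - rewrite pw_nonpos, Rmult_0_r by lra. apply (is_derive_ext_loc (fun _ => 0)).
    + apply (filter_imp (fun y => y < 0)); [|exact (open_lt 0 x Hx)].
      intros y Hy. rewrite pw_nonpos; lra.
    + apply (is_derive_const (V := R_NormedModule)).
  - assert (He : 0 < e - 1) by lra.
    rewrite pw_nonpos, Rmult_0_r by lra. apply is_derive_Reals. intros eps Heps.
    destruct (continuity_pt_pw 0 (e - 1) (Rlt_le _ _ He) eps Heps) as (d & Hd & Hpw).
    exists (mkposreal d Hd). intros h Hh0 Hh. simpl in Hh.
    rewrite Rplus_0_l, (pw_nonpos 0), !Rminus_0_r by lra.
    specialize (Hpw h). simpl in Hpw. unfold R_dist in Hpw.
    rewrite (pw_nonpos 0), !Rminus_0_r in Hpw by lra.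
    replace (pw h e / h) with (pw h (e - 1)).
    + apply Hpw. repeat split; auto.
    + destruct (Rlt_dec 0 h) as [Hp|Hp].
      * rewrite (pw_pred h e) by lra. now field.
      * rewrite !pw_nonpos by lra. unfold Rdiv. ring.
  - rewrite pw_Rpower by exact Hx. apply (is_derive_ext_loc (fun y => Rpower y e)).
    + apply (filter_imp (fun y => 0 < y)); [|exact (open_gt 0 x Hx)].
      intros y Hy. now rewrite pw_Rpower.
    + now apply is_derive_Reals, derivable_pt_lim_power.
Qed.

Lemma pw_one_minus_ge (b x : R) : 1 <= b -> 0 <= x -> 1 - b * x <= pw (1 - x) b.
Proof.
  intros Hb Hx. destruct (Rle_dec x 1) as [Hx1|]; [|pose proof (pw_ge0 (1 - x) b); nra].
  enough (pw (1 - 0) b + b * 0 <= pw (1 - x) b + b * x) by (rewrite Rminus_0_r, pw_1_l in *; lra).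
  assert (Daffine : forall y, is_derive (fun y => 1 - y) y (- 1))
    by (intros y; auto_derive; [trivial|ring]).
  apply (le_of_derive_ge0 (fun y => pw (1 - y) b + b * y)
    (fun y => b * (1 - pw (1 - y) (b - 1))) 0 x Hx).
  - intros y _. apply continuity_pt_plus.
    + apply (continuity_pt_comp (fun y => 1 - y) (fun z => pw z b)).
      * exact (continuity_pt_of_is_derive _ _ _ (Daffine y)).
      * apply continuity_pt_pw. lra.
    + apply continuity_pt_scal, continuity_pt_id.
  - intros y Hy.
    replace (b * (1 - pw (1 - y) (b - 1))) with (- 1 * (b * pw (1 - y) (b - 1)) + b) by ring.
    apply (is_derive_plus (V := R_NormedModule) (fun y => pw (1 - y) b)).
    + apply (is_derive_comp (fun z => pw z b)); [apply is_derive_pw; lra|apply Daffine].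
    + auto_derive; [trivial|ring].
  - intros y Hy. apply Rmult_le_pos; [lra|]. pose proof (pw_le_1 (1 - y) (b - 1)). lra.
Qed.
(** * Young functions *)

Lemma is_derive_RInt_of_continuity (f : R -> R) (a b : R) :
  continuity f -> is_derive (fun u => RInt f a u) b (f b).
Proof.
  intros Hf. assert (Hc : forall x, continuous f x).
  { intros x. apply continuity_pt_filterlim, Hf. }
  apply (is_derive_RInt f (fun u => RInt f a u) a b); [|apply Hc].
  apply filter_forall. intros u. apply (RInt_correct (V := R_CompleteNormedModule)).
  apply (ex_RInt_continuous (V := R_CompleteNormedModule)). intros x _. apply Hc.
Qed.

Definition pw_moment (k : R) (g : R -> R) (y : R) : R :=
  RInt (fun s => k * pw s (k - 1) * g s) 0 y.

Lemma is_derive_pw_moment (k : R) (g : R -> R) (y : R) :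
  1 <= k -> continuity g -> is_derive (pw_moment k g) y (k * pw y (k - 1) * g y).
Proof.
  intros Hk Hg. apply (is_derive_RInt_of_continuity (fun s => k * pw s (k - 1) * g s) 0 y).
  intros s. apply continuity_pt_mult; [|apply Hg].
  apply (continuity_pt_scal (fun s => pw s (k - 1))), continuity_pt_pw. lra.
Qed.

Lemma pw_moment_0 (k : R) (g : R -> R) : pw_moment k g 0 = 0.
Proof. exact (RInt_point (V := R_CompleteNormedModule) 0 _). Qed.

Lemma pw_moment_approx (k : R) (g F G dF dG : R -> R) (y : R) :
  1 <= k -> 0 <= y -> continuity g -> continuity F -> continuity G ->
  (forall s, 0 < s -> is_derive F s (dF s)) ->
  (forall s, 0 < s -> is_derive G s (dG s)) ->
  (forall s, 0 <= s <= y -> Rabs (k * pw s (k - 1) * g s - dF s) <= dG s) ->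
  Rabs (pw_moment k g y - (F y - F 0)) <= G y - G 0.
Proof.
  intros Hk Hy Cg CF CG DF DG Hle.
  replace (pw_moment k g y - (F y - F 0)) with
    ((pw_moment k g y - F y) - (pw_moment k g 0 - F 0)) by (rewrite pw_moment_0; ring).
  apply (Rabs_diff_le_of_derive (fun s => pw_moment k g s - F s) G
    (fun s => k * pw s (k - 1) * g s - dF s) dG); auto.
  - intros s _. apply (continuity_pt_minus (pw_moment k g) F); [|apply CF].
    exact (continuity_pt_of_is_derive _ _ _ (is_derive_pw_moment k g s Hk Cg)).
  - intros s Hs. apply (is_derive_minus (V := R_NormedModule) (pw_moment k g) F).
    + now apply is_derive_pw_moment.
    + now apply DF.
  - intros s Hs. now apply DG.
Qed.

Lemma pw_moment_eq (k : R) (g F : R -> R) (y : R) :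
  1 <= k -> 0 <= y -> continuity g -> continuity F ->
  (forall s, 0 < s -> is_derive F s (k * pw s (k - 1) * g s)) ->
  pw_moment k g y = F y - F 0.
Proof.
  intros Hk Hy Cg CF DF.
  enough (Hle : Rabs (pw_moment k g y - (F y - F 0)) <= 0 - 0).
  { rewrite Rminus_0_r in Hle. apply Rabs_le_between in Hle. lra. }
  apply (pw_moment_approx k g F (fun _ => 0) (fun s => k * pw s (k - 1) * g s) (fun _ => 0));
    auto.
  - apply continuity_const. now intros ? ?.
  - intros s _. apply (is_derive_const (V := R_NormedModule)).
  - intros s _. rewrite Rminus_diag, Rabs_R0. lra.
Qed.

Lemma continuity_pw_mult (k : R) (g : R -> R) :
  0 <= k -> continuity g -> continuity (fun s => pw s k * g s).
Proof. intros Hk Hg s. apply continuity_pt_mult; [now apply continuity_pt_pw|apply Hg]. Qed.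

Lemma is_derive_pw_mult (k : R) (g : R -> R) (s d : R) :
  0 < s -> is_derive g s d ->
  is_derive (fun s => pw s k * g s) s (k * pw s (k - 1) * g s + pw s k * d).
Proof.
  intros Hs Hg. apply (is_derive_mult (K := R_AbsRing) (fun s => pw s k) g).
  - apply is_derive_pw. now left.
  - exact Hg.
  - intros ? ?. apply Rmult_comm.
Qed.

Lemma is_derive_cos_reflect (y s : R) : is_derive (fun s => cos (y - s)) s (sin (y - s)).
Proof. auto_derive; [trivial|]. unfold Rminus. ring. Qed.

Lemma is_derive_sin_reflect (y s : R) : is_derive (fun s => sin (y - s)) s (- cos (y - s)).
Proof. auto_derive; [trivial|]. unfold Rminus. ring. Qed.

Lemma continuity_cos_reflect (y : R) : continuity (fun s => cos (y - s)).
Proof. exact (continuity_of_is_derive _ _ (is_derive_cos_reflect y)). Qed.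

Lemma continuity_sin_reflect (y : R) : continuity (fun s => sin (y - s)).
Proof. exact (continuity_of_is_derive _ _ (is_derive_sin_reflect y)). Qed.

Lemma Rabs_sin_le_1 (x : R) : Rabs (sin x) <= 1.
Proof. apply Rabs_le, SIN_bound. Qed.

Lemma Rabs_cos_le_1 (x : R) : Rabs (cos x) <= 1.
Proof. apply Rabs_le, COS_bound. Qed.

Definition young_cos (k y : R) : R := pw_moment k (fun s => cos (y - s)) y.

Lemma young_cos_split (k y : R) : 1 <= k -> 0 <= y ->
  young_cos k y = cos y * pw_moment k cos y + sin y * pw_moment k sin y.
Proof.
  intros Hk Hy. unfold young_cos.
  assert (D : forall s, is_derive (fun s => cos y * pw_moment k cos s + sin y * pw_moment k sin s) s
    (k * pw s (k - 1) * cos (y - s))).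
  { intros s. rewrite cos_minus.
    replace (k * pw s (k - 1) * (cos y * cos s + sin y * sin s)) with
      (cos y * (k * pw s (k - 1) * cos s) + sin y * (k * pw s (k - 1) * sin s)) by ring.
    apply (is_derive_plus (V := R_NormedModule) (fun s => cos y * pw_moment k cos s)
      (fun s => sin y * pw_moment k sin s));
      apply is_derive_scal, is_derive_pw_moment; auto.
    - apply continuity_cos.
    - apply continuity_sin. }
  rewrite (pw_moment_eq k _ (fun s => cos y * pw_moment k cos s + sin y * pw_moment k sin s)); auto.
  - rewrite !pw_moment_0. ring.
  - apply continuity_cos_reflect.
  - exact (continuity_of_is_derive _ _ D).
Qed.

Lemma pw_mult_young (k x : R) : 1 <= k -> 0 < x -> pw x k * young k x = young_cos k x.
Proof.
  intros Hk Hx. unfold young. destruct (Req_EM_T x 0) as [E|_]; [lra|].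
  set (f := fun t => pw (1 - t / x) (k - 1) * cos t).
  assert (Cf : continuity f).
  { intros t. apply continuity_pt_mult; [|apply continuity_cos].
    apply (continuity_pt_comp (fun t => 1 - t / x) (fun z => pw z (k - 1))).
    - apply continuity_pt_of_is_derive with (- (1 / x)). auto_derive; [trivial|]. field. lra.
    - apply continuity_pt_pw. lra. }
  assert (DI : forall t, is_derive (fun b => RInt f 0 b) t (f t)).
  { intros t. now apply is_derive_RInt_of_continuity. }
  assert (D : forall s, 0 < s -> is_derive (fun s => - (k * pw x (k - 1)) * RInt f 0 (x - s)) s
    (k * pw s (k - 1) * cos (x - s))).
  { intros s Hs.
    replace (k * pw s (k - 1) * cos (x - s)) with (- (k * pw x (k - 1)) * (- 1 * f (x - s))).
    - apply is_derive_scal, (is_derive_comp (fun b => RInt f 0 b)); [apply DI|].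
      auto_derive; [trivial|ring].
    - unfold f. replace s with ((1 - (x - s) / x) * x) at 3 by (field; lra).
      rewrite pw_mult by exact Hx. ring. }
  unfold young_cos.
  rewrite (pw_moment_eq k _ (fun s => - (k * pw x (k - 1)) * RInt f 0 (x - s))); auto; try lra.
  - rewrite Rminus_diag, Rminus_0_r, (RInt_point (V := R_CompleteNormedModule)).
    unfold zero; simpl. rewrite (pw_pred x k) by lra. field. lra.
  - apply continuity_cos_reflect.
  - intros s. apply (continuity_pt_scal (fun s => RInt f 0 (x - s))).
    apply (continuity_pt_comp (fun s => x - s) (fun b => RInt f 0 b)).
    + apply continuity_pt_of_is_derive with (- 1). auto_derive; [trivial|ring].
    + exact (continuity_pt_of_is_derive _ _ _ (DI _)).
Qed.

Lemma young_0 (k : R) : young k 0 = 1.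
Proof. unfold young. destruct (Req_EM_T 0 0); [reflexivity|lra]. Qed.

Lemma Rabs_cos_minus_1_le (x : R) : 0 <= x -> Rabs (cos x - 1) <= x.
Proof.
  intros Hx. rewrite <- cos_0. rewrite <- (Rminus_0_r x) at 2.
  apply (Rabs_diff_le_of_derive cos (fun x => x) (fun x => - sin x) (fun _ => 1)); auto.
  - intros y _. apply continuity_cos.
  - intros y _. apply continuity_pt_id.
  - intros y _. auto_derive; [trivial|ring].
  - intros y _. apply (is_derive_id (K := R_AbsRing)).
  - intros y _. rewrite Rabs_Ropp. apply Rabs_sin_le_1.
Qed.

Lemma young_cos_le (k y : R) : 1 <= k -> 0 <= y -> Rabs (young_cos k y) <= pw y k.
Proof.
  intros Hk Hy. unfold young_cos.
  pose proof (pw_moment_approx k (fun s => cos (y - s)) (fun _ => 0) (fun s => pw s k)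
    (fun _ => 0) (fun s => k * pw s (k - 1)) y) as Happrox.
  simpl in Happrox. rewrite (pw_nonpos 0), !Rminus_0_r in Happrox by lra.
  apply Happrox; auto.
  - apply continuity_cos_reflect.
  - apply continuity_const. now intros ? ?.
  - intros s. apply continuity_pt_pw. lra.
  - intros s _. apply (is_derive_const (V := R_NormedModule)).
  - intros s Hs. apply is_derive_pw. now left.
  - intros s _. rewrite Rminus_0_r, Rabs_mult.
    assert (Hpos : 0 <= k * pw s (k - 1)) by (apply Rmult_le_pos; [lra|apply pw_ge0]).
    rewrite Rabs_pos_eq by exact Hpos. pose proof (Rabs_cos_le_1 (y - s)). nra.
Qed.

Lemma pw_moment_approx_linear (k c y : R) (g F dF : R -> R) :
  1 <= k -> 0 <= y -> continuity g -> continuity F ->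
  (forall s, 0 < s -> is_derive F s (dF s)) ->
  (forall s, 0 <= s <= y ->
     Rabs (k * pw s (k - 1) * g s - dF s) <= c * (k * pw s (k - 1) * (y - s))) ->
  Rabs (pw_moment k g y - (F y - F 0)) <= c * (pw y k * (y / (k + 1))).
Proof.
  intros Hk Hy Cg CF DF Hle.
  assert (Cpw : forall e, 0 <= e -> continuity (fun s => pw s e)).
  { intros e He s. now apply continuity_pt_pw. }
  set (G := fun s => c * (y * pw s k - k / (k + 1) * pw s (k + 1))).
  assert (EG : G y - G 0 = c * (pw y k * (y / (k + 1)))).
  { unfold G. rewrite !(pw_nonpos 0), (pw_pred y (k + 1)) by lra.
    replace (k + 1 - 1) with k by ring. field. lra. }
  rewrite <- EG.
  apply (pw_moment_approx k g F G dF (fun s => c * (k * pw s (k - 1) * (y - s)))); auto.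
  - intros s. apply (continuity_pt_scal (fun s => y * pw s k - k / (k + 1) * pw s (k + 1))).
    apply continuity_pt_minus; apply continuity_pt_scal, Cpw; lra.
  - intros s Hs. apply (is_derive_scal (fun s => y * pw s k - k / (k + 1) * pw s (k + 1))).
    replace (k * pw s (k - 1) * (y - s)) with
      (y * (k * pw s (k - 1)) - k / (k + 1) * ((k + 1) * pw s (k + 1 - 1))).
    + apply (is_derive_minus (V := R_NormedModule) (fun s => y * pw s k)
        (fun s => k / (k + 1) * pw s (k + 1))).
      * apply (is_derive_scal (fun s => pw s k)), is_derive_pw. now left.
      * apply (is_derive_scal (fun s => pw s (k + 1))), is_derive_pw. now left.
    + replace (k + 1 - 1) with k by ring. rewrite (pw_pred s k) by lra. field. lra.
Qed.

Lemma young_cos_minus_pw_le (k y : R) : 1 <= k -> 0 <= y ->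
  Rabs (young_cos k y - pw y k) <= pw y k * (y / (k + 1)).
Proof.
  intros Hk Hy. unfold young_cos.
  replace (pw y k) with (pw y k - pw 0 k) at 1 by (rewrite (pw_nonpos 0) by lra; ring).
  rewrite <- (Rmult_1_l (_ * (y / _))).
  apply (pw_moment_approx_linear k 1 y _ (fun s => pw s k) (fun s => k * pw s (k - 1))); auto.
  - apply continuity_cos_reflect.
  - intros s. apply continuity_pt_pw. lra.
  - intros s Hs. apply is_derive_pw. now left.
  - intros s Hs. set (q := pw s (k - 1)).
    assert (Hq : 0 <= k * q) by (apply Rmult_le_pos; [lra|apply pw_ge0]).
    replace (k * q * cos (y - s) - k * q) with (k * q * (cos (y - s) - 1)) by ring.
    rewrite Rmult_1_l, Rabs_mult, Rabs_pos_eq by exact Hq.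
    apply Rmult_le_compat_l, Rabs_cos_minus_1_le; lra.
Qed.

(* Integration by parts in disguise: for [k < 2] the exponent [k - 2] is singular at [0]. *)
Lemma young_cos_decay (k y : R) : 1 <= k -> 0 <= y -> Rabs (young_cos k y) <= k * pw y (k - 1).
Proof.
  intros Hk Hy. unfold young_cos.
  assert (Cpw : continuity (fun s => pw s (k - 1))) by (intros s; apply continuity_pt_pw; lra).
  pose proof (pw_moment_approx k (fun s => cos (y - s))
    (fun s => - k * (pw s (k - 1) * sin (y - s))) (fun s => k * pw s (k - 1))
    (fun s => - k * ((k - 1) * pw s (k - 1 - 1) * sin (y - s) + pw s (k - 1) * - cos (y - s)))
    (fun s => k * ((k - 1) * pw s (k - 1 - 1))) y) as Happrox.
  simpl in Happrox. rewrite Rminus_diag, sin_0, !Rmult_0_r, Rminus_0_r in Happrox.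
  set (b := pw 0 (k - 1)) in *.
  assert (Hbound : Rabs (pw_moment k (fun s => cos (y - s)) y - (0 - - k * (b * sin y)))
                     <= k * pw y (k - 1) - k * b).
  { apply Happrox; auto.
    - apply continuity_cos_reflect.
    - intros s. apply (continuity_pt_scal (fun s => pw s (k - 1) * sin (y - s))).
      apply continuity_pw_mult; [lra|apply continuity_sin_reflect].
    - intros s. apply continuity_pt_scal, Cpw.
    - intros s Hs. apply (is_derive_scal (fun s => pw s (k - 1) * sin (y - s))).
      apply (is_derive_pw_mult (k - 1) (fun s => sin (y - s))); [exact Hs|].
      apply is_derive_sin_reflect.
    - intros s Hs. apply (is_derive_scal (fun s => pw s (k - 1))), is_derive_pw. now left.
    - intros s _. set (q := (k - 1) * pw s (k - 1 - 1)).
      assert (Hq : 0 <= k * q).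
      { apply Rmult_le_pos; [lra|]. apply Rmult_le_pos; [lra|apply pw_ge0]. }
      replace (k * pw s (k - 1) * cos (y - s)
               - - k * (q * sin (y - s) + pw s (k - 1) * - cos (y - s))) with
        (k * q * sin (y - s)) by ring.
      rewrite Rabs_mult, Rabs_pos_eq by exact Hq. pose proof (Rabs_sin_le_1 (y - s)). nra. }
  assert (Hkb : 0 <= k * b) by (apply Rmult_le_pos; [lra|apply pw_ge0]).
  pose proof (SIN_bound y). apply Rabs_le_between in Hbound. apply Rabs_le. nra.
Qed.

(* [s^k (cos (y - s) - x sin (y - s))] is nearly a primitive of [(1 + x^2) k s^(k - 1) cos (y - s)]:
   the error is [s^(k - 1) (y - s) (x cos (y - s) + sin (y - s))]. *)
Lemma young_cos_cauchy (k x : R) : 1 <= k -> 0 <= x ->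
  Rabs (young_cos k (k * x) - pw (k * x) k * / (1 + x * x)) <=
  pw (k * x) k * (/ (1 + x * x) * ((1 + x) * x / (k + 1))).
Proof.
  intros Hk Hx. set (y := k * x). assert (Hy : 0 <= y) by (apply Rmult_le_pos; lra).
  set (v := / (1 + x * x)). assert (Hv : 0 < v) by (apply Rinv_0_lt_compat; nra).
  assert (Ev : v * (1 + x * x) = 1) by (apply Rinv_l; nra).
  set (g := fun s => v * (cos (y - s) - x * sin (y - s))).
  assert (Dg : forall s, is_derive g s (v * (sin (y - s) + x * cos (y - s)))).
  { intros s. unfold g. auto_derive; [trivial|]. unfold Rminus. ring. }
  replace (pw y k * v) with (pw y k * g y - pw 0 k * g 0).
  2:{ unfold g. rewrite (pw_nonpos 0), Rminus_diag, cos_0, sin_0 by lra. ring. }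
  replace (pw y k * (v * ((1 + x) * x / (k + 1)))) with
    (v * (1 + x) / k * (pw y k * (y / (k + 1)))) by (unfold y; field; lra).
  apply (pw_moment_approx_linear k (v * (1 + x) / k) y _ (fun s => pw s k * g s)
    (fun s => k * pw s (k - 1) * g s + pw s k * (v * (sin (y - s) + x * cos (y - s))))); auto.
  - apply continuity_cos_reflect.
  - apply continuity_pw_mult; [lra|]. exact (continuity_of_is_derive _ _ Dg).
  - intros s Hs. now apply is_derive_pw_mult.
  - intros s Hs. rewrite (pw_pred s k) by lra. unfold g.
    set (q := pw s (k - 1)). set (C := cos (y - s)). set (S := sin (y - s)).
    assert (Hq : 0 <= v * q * (y - s)).
    { apply Rmult_le_pos; [|lra]. apply Rmult_le_pos; [lra|apply pw_ge0]. }
    replace (k * q * C - (k * q * (v * (C - x * S)) + s * q * (v * (S + x * C)))) with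
      (v * q * (y - s) * (x * C + S)).
    2:{ replace (k * q * C) with (v * (1 + x * x) * (k * q * C)) by (rewrite Ev; ring).
        unfold y. ring. }
    replace (v * (1 + x) / k * (k * q * (y - s))) with (v * q * (y - s) * (1 + x))
      by (field; lra).
    rewrite Rabs_mult, (Rabs_pos_eq _ Hq). apply Rmult_le_compat_l; [exact Hq|].
    eapply Rle_trans; [apply Rabs_triang|]. rewrite Rabs_mult, (Rabs_pos_eq x Hx).
    pose proof (Rabs_cos_le_1 (y - s)). pose proof (Rabs_sin_le_1 (y - s)).
    unfold C, S. nra.
Qed.

Lemma pw_moment_by_parts (k : R) (g dg : R -> R) (y : R) :
  1 <= k -> 0 <= y -> continuity dg -> (forall s, is_derive g s (dg s)) ->
  pw_moment (k + 1) dg y = (k + 1) * (pw y k * g y - pw_moment k g y).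
Proof.
  intros Hk Hy Cdg Dg. pose proof (continuity_of_is_derive g dg Dg) as Cg.
  rewrite (pw_moment_eq (k + 1) dg (fun s => (k + 1) * (pw s k * g s - pw_moment k g s))); auto.
  - rewrite pw_moment_0, (pw_nonpos 0) by lra. ring.
  - lra.
  - intros s. apply (continuity_pt_scal (fun s => pw s k * g s - pw_moment k g s)).
    apply continuity_pt_minus.
    + apply continuity_pw_mult; [lra|exact Cg].
    + exact (continuity_pt_of_is_derive _ _ _ (is_derive_pw_moment k g s Hk Cg)).
  - intros s Hs.
    replace ((k + 1) * pw s (k + 1 - 1) * dg s) with
      ((k + 1) * ((k * pw s (k - 1) * g s + pw s k * dg s) - k * pw s (k - 1) * g s))
      by (replace (k + 1 - 1) with k by ring; ring).
    apply (is_derive_scal (fun s => pw s k * g s - pw_moment k g s)).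
    apply (is_derive_minus (V := R_NormedModule) (fun s => pw s k * g s) (pw_moment k g)).
    + now apply is_derive_pw_mult.
    + now apply is_derive_pw_moment.
Qed.

Lemma pw_moment_opp (k : R) (g : R -> R) (y : R) :
  1 <= k -> 0 <= y -> continuity g -> pw_moment k (fun s => - g s) y = - pw_moment k g y.
Proof.
  intros Hk Hy Hg. assert (D : forall s, is_derive (fun s => - pw_moment k g s) s
                                           (k * pw s (k - 1) * - g s)).
  { intros s. rewrite Ropp_mult_distr_r_reverse.
    now apply (is_derive_opp (V := R_NormedModule) (pw_moment k g)), is_derive_pw_moment. }
  rewrite (pw_moment_eq k (fun s => - g s) (fun s => - pw_moment k g s)), pw_moment_0; auto.
  - ring.
  - now apply continuity_opp.
  - exact (continuity_of_is_derive _ _ D).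
Qed.

Lemma young_cos_succ (k y : R) : 1 <= k -> 0 <= y ->
  young_cos (k + 1) y = (k + 1) * (sin y * pw_moment k cos y - cos y * pw_moment k sin y).
Proof.
  intros Hk Hy. rewrite young_cos_split by lra.
  rewrite (pw_moment_by_parts k sin cos), (pw_moment_by_parts k (fun s => - cos s) sin); auto.
  - rewrite pw_moment_opp by (auto; apply continuity_cos). ring.
  - apply continuity_sin.
  - intros s. auto_derive; [trivial|ring].
  - apply continuity_cos.
  - intros s. auto_derive; [trivial|ring].
Qed.

Lemma is_derive_young_cos_succ (k y : R) : 1 <= k -> 0 < y ->
  is_derive (young_cos (k + 1)) y ((k + 1) * young_cos k y).
Proof.
  intros Hk Hy. rewrite young_cos_split by lra.
  apply (is_derive_ext_loc
    (fun y => (k + 1) * (sin y * pw_moment k cos y - cos y * pw_moment k sin y))).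
  { apply (filter_imp (fun y => 0 < y)); [|exact (open_gt 0 y Hy)].
    intros z Hz. rewrite young_cos_succ; lra. }
  apply (is_derive_scal (fun y => sin y * pw_moment k cos y - cos y * pw_moment k sin y)).
  replace (cos y * pw_moment k cos y + sin y * pw_moment k sin y) with
    ((cos y * pw_moment k cos y + sin y * (k * pw y (k - 1) * cos y)) -
     (- sin y * pw_moment k sin y + cos y * (k * pw y (k - 1) * sin y))) by ring.
  apply (is_derive_minus (V := R_NormedModule) (fun y => sin y * pw_moment k cos y)
    (fun y => cos y * pw_moment k sin y)).
  - apply (is_derive_mult (K := R_AbsRing) sin (pw_moment k cos)).
    + apply is_derive_sin.
    + apply is_derive_pw_moment; [exact Hk|apply continuity_cos].
    + intros ? ?. apply Rmult_comm.
  - apply (is_derive_mult (K := R_AbsRing) cos (pw_moment k sin)).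
    + apply is_derive_cos.
    + apply is_derive_pw_moment; [exact Hk|apply continuity_sin].
    + intros ? ?. apply Rmult_comm.
Qed.

Lemma young_div_pw (k x : R) : 1 <= k -> 0 < x -> young k x = young_cos k x / pw x k.
Proof.
  intros Hk Hx. rewrite <- pw_mult_young by assumption.
  field. apply Rgt_not_eq, pw_pos, Hx.
Qed.

Lemma is_derive_young_succ (k x : R) : 1 <= k -> 0 < x ->
  is_derive (young (k + 1)) x ((k + 1) * (young k x - young (k + 1) x) / x).
Proof.
  intros Hk Hx. pose proof (pw_pos x (k + 1) Hx) as Hpw.
  apply (is_derive_ext_loc (fun x => young_cos (k + 1) x / pw x (k + 1))).
  { apply (filter_imp (fun y => 0 < y)); [|exact (open_gt 0 x Hx)].
    intros z Hz. rewrite young_div_pw; lra. }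
  replace ((k + 1) * (young k x - young (k + 1) x) / x) with
    (((k + 1) * young_cos k x * pw x (k + 1)
      - young_cos (k + 1) x * ((k + 1) * pw x (k + 1 - 1))) / pw x (k + 1) ^ 2).
  - apply (is_derive_div (young_cos (k + 1)) (fun x => pw x (k + 1))).
    + now apply is_derive_young_cos_succ.
    + apply is_derive_pw. now left.
    + lra.
  - rewrite <- !pw_mult_young by lra. replace (k + 1 - 1) with k by ring.
    rewrite (pw_pred x (k + 1)) by lra. replace (k + 1 - 1) with k by ring.
    pose proof (pw_pos x k Hx). field. lra.
Qed.

Lemma continuity_pt_young (k x : R) : 1 <= k -> 0 < x -> continuity_pt (young k) x.
Proof.
  intros Hk Hx.
  apply (continuity_pt_ext_loc
    (fun x => (cos x * pw_moment k cos x + sin x * pw_moment k sin x) / pw x k)).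
  { apply (filter_imp (fun y => 0 < y)); [|exact (open_gt 0 x Hx)].
    intros z Hz. rewrite young_div_pw, young_cos_split; lra. }
  assert (Cmoment : forall g, continuity g -> continuity (pw_moment k g)).
  { intros g Hg y. exact (continuity_pt_of_is_derive _ _ _ (is_derive_pw_moment k g y Hk Hg)). }
  apply continuity_pt_div.
  - apply (continuity_plus (fun x => cos x * pw_moment k cos x)
      (fun x => sin x * pw_moment k sin x)).
    + apply continuity_mult; [|apply Cmoment]; apply continuity_cos.
    + apply continuity_mult; [|apply Cmoment]; apply continuity_sin.
  - apply continuity_pt_pw. lra.
  - apply Rgt_not_eq, pw_pos, Hx.
Qed.

Lemma young_le_1 (k x : R) : 1 <= k -> 0 <= x -> Rabs (young k x) <= 1.
Proof.
  intros Hk [Hx|<-]; [|rewrite young_0, Rabs_R1; lra].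
  pose proof (pw_pos x k Hx). apply Rmult_le_reg_l with (pw x k); [assumption|].
  rewrite <- (Rabs_pos_eq (pw x k)) at 1 by lra.
  rewrite <- Rabs_mult, pw_mult_young, Rmult_1_r by assumption. apply young_cos_le; lra.
Qed.

Lemma young_decay (k x : R) : 1 <= k -> 0 <= x -> Rabs (young k x) * x <= k.
Proof.
  intros Hk [Hx|<-]; [|lra].
  pose proof (pw_pos x (k - 1) Hx). apply Rmult_le_reg_l with (pw x (k - 1)); [assumption|].
  replace (pw x (k - 1) * (Rabs (young k x) * x)) with (x * pw x (k - 1) * Rabs (young k x))
    by ring.
  rewrite <- pw_pred, <- (Rabs_pos_eq (pw x k)), <- Rabs_mult, pw_mult_young
    by (try apply pw_ge0; lra).
  rewrite Rmult_comm with (r2 := k). apply young_cos_decay; lra.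
Qed.

Lemma young_minus_1_le (k x : R) : 1 <= k -> 0 <= x -> Rabs (young k x - 1) <= x / (k + 1).
Proof.
  intros Hk [Hx|<-]; [|rewrite young_0, Rminus_diag, Rabs_R0; unfold Rdiv; lra].
  pose proof (pw_pos x k Hx). apply Rmult_le_reg_l with (pw x k); [assumption|].
  rewrite <- (Rabs_pos_eq (pw x k)) at 1 by lra.
  rewrite <- Rabs_mult, Rmult_minus_distr_l, pw_mult_young, Rmult_1_r by assumption.
  apply young_cos_minus_pw_le; lra.
Qed.

Lemma young_dilated_minus_cauchy_le (k x : R) : 1 <= k -> 0 <= x ->
  Rabs (young k (k * x) - / (1 + x * x)) <= 2 / (k + 1).
Proof.
  intros Hk Hx. assert (Hv : 0 < / (1 + x * x)) by (apply Rinv_0_lt_compat; nra).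
  apply Rle_trans with (/ (1 + x * x) * ((1 + x) * x / (k + 1))).
  - destruct Hx as [Hx|<-].
    + assert (Hkx : 0 < k * x) by (apply Rmult_lt_0_compat; lra).
      pose proof (pw_pos (k * x) k Hkx). apply Rmult_le_reg_l with (pw (k * x) k); [assumption|].
      rewrite <- (Rabs_pos_eq (pw (k * x) k)) at 1 by lra.
      rewrite <- Rabs_mult, Rmult_minus_distr_l, pw_mult_young by assumption.
      apply young_cos_cauchy; lra.
    + rewrite !Rmult_0_r, young_0, Rplus_0_r, Rinv_1, Rminus_diag, Rabs_R0. unfold Rdiv. lra.
  - replace (/ (1 + x * x) * ((1 + x) * x / (k + 1))) with
      ((1 + x) * x / (1 + x * x) / (k + 1)) by (field; nra).
    apply Rmult_le_compat_r; [left; apply Rinv_0_lt_compat; lra|].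
    apply Rle_div_l; nra.
Qed.

(** * Kernels *)

Definition kernel_bound (B : R) (phi : R -> R) : Prop :=
  forall x, 0 <= x -> Rabs (phi x) * (1 + x) <= B /\ Rabs (phi x - phi 0) <= B * x.

Definition is_kernel (phi : R -> R) : Prop := exists B, kernel_bound B phi.

Lemma kernel_bound_ge0 (B : R) (phi : R -> R) : kernel_bound B phi -> 0 <= B.
Proof. intros H. destruct (H 0 (Rle_refl 0)) as [H0 _]. pose proof (Rabs_pos (phi 0)). lra. Qed.

Lemma kernel_bound_plus (B B' : R) (phi psi : R -> R) :
  kernel_bound B phi -> kernel_bound B' psi -> kernel_bound (B + B') (fun x => phi x + psi x).
Proof.
  intros H H' x Hx. destruct (H x Hx) as [H1 H2]. destruct (H' x Hx) as [H1' H2'].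
  pose proof (Rabs_triang (phi x) (psi x)).
  pose proof (Rabs_triang (phi x - phi 0) (psi x - psi 0)).
  replace (phi x + psi x - (phi 0 + psi 0)) with ((phi x - phi 0) + (psi x - psi 0)) by ring.
  nra.
Qed.

Lemma kernel_bound_scal (c B : R) (phi : R -> R) :
  kernel_bound B phi -> kernel_bound (Rabs c * B) (fun x => c * phi x).
Proof.
  intros H x Hx. destruct (H x Hx) as [H1 H2]. pose proof (Rabs_pos c).
  rewrite <- Rmult_minus_distr_l, !Rabs_mult. nra.
Qed.

Lemma kernel_bound_minus (B B' : R) (phi psi : R -> R) :
  kernel_bound B phi -> kernel_bound B' psi -> kernel_bound (B + B') (fun x => phi x - psi x).
Proof.
  intros H H' x Hx.
  pose proof (kernel_bound_plus _ _ _ _ H (kernel_bound_scal (- 1) _ _ H') x Hx) as Hsum.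
  rewrite Rabs_m1, Rmult_1_l in Hsum.
  replace (phi x + - 1 * psi x) with (phi x - psi x) in Hsum by ring.
  replace (phi 0 + - 1 * psi 0) with (phi 0 - psi 0) in Hsum by ring. exact Hsum.
Qed.

Lemma is_kernel_dilate (s : R) (phi : R -> R) :
  0 < s -> is_kernel phi -> is_kernel (fun x => phi (s * x)).
Proof.
  intros Hs [B HB]. exists (B * (1 + s + / s)). intros x Hx.
  pose proof (kernel_bound_ge0 B phi HB) as HB0.
  assert (Hsi : 0 < / s) by now apply Rinv_0_lt_compat.
  assert (Ess : / s * s = 1) by (apply Rinv_l; lra).
  assert (Hsx : 0 <= s * x) by (apply Rmult_le_pos; lra).
  destruct (HB (s * x) Hsx) as [H1 H2]. rewrite Rmult_0_r. split.
  - assert (Hle : 1 + x <= (1 + s * x) * (1 + / s)).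
    { replace ((1 + s * x) * (1 + / s)) with (1 + s * x + / s + / s * s * x) by ring.
      rewrite Ess. lra. }
    apply Rle_trans with (Rabs (phi (s * x)) * ((1 + s * x) * (1 + / s))).
    + apply Rmult_le_compat_l; [apply Rabs_pos|exact Hle].
    + rewrite <- Rmult_assoc. apply Rle_trans with (B * (1 + / s)); [|nra].
      apply Rmult_le_compat_r; lra.
  - apply Rle_trans with (B * (s * x)); [exact H2|]. rewrite Rmult_assoc.
    apply Rmult_le_compat_l; [exact HB0|]. apply Rmult_le_compat_r; lra.
Qed.

Definition abel_kernel (x : R) : R := exp (- x).

Definition riesz_kernel (b x : R) : R := pw (1 - x) b.

Definition cauchy_kernel (x : R) : R := / (1 + x * x).

Lemma abel_kernel_0 : abel_kernel 0 = 1.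
Proof. unfold abel_kernel. now rewrite Ropp_0, exp_0. Qed.

Lemma riesz_kernel_0 (b : R) : riesz_kernel b 0 = 1.
Proof. unfold riesz_kernel. now rewrite Rminus_0_r, pw_1_l. Qed.

Lemma cauchy_kernel_0 : cauchy_kernel 0 = 1.
Proof. unfold cauchy_kernel. field. Qed.

Lemma abel_kernel_le_inv (x : R) : 0 <= x -> abel_kernel x * (1 + x) <= 1.
Proof.
  intros Hx. apply Rle_trans with (exp (- x) * exp x).
  - apply Rmult_le_compat_l; [left; apply exp_pos|apply exp_ineq1_le].
  - rewrite <- exp_plus, Rplus_opp_l, exp_0. lra.
Qed.

Lemma kernel_bound_abel : kernel_bound 1 abel_kernel.
Proof.
  intros x Hx. pose proof (exp_neg_bounds x Hx) as He. rewrite abel_kernel_0. split.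
  - rewrite Rabs_pos_eq by (unfold abel_kernel; lra). now apply abel_kernel_le_inv.
  - unfold abel_kernel. rewrite Rabs_minus_sym, Rabs_pos_eq by lra.
    pose proof (exp_ineq1_le (- x)). lra.
Qed.

Lemma kernel_bound_cauchy : kernel_bound 2 cauchy_kernel.
Proof.
  intros x Hx. rewrite cauchy_kernel_0. unfold cauchy_kernel.
  assert (Hv : 0 < / (1 + x * x)) by (apply Rinv_0_lt_compat; nra). split.
  - rewrite Rabs_pos_eq, Rmult_comm by lra. apply Rle_div_l; nra.
  - replace (/ (1 + x * x) - 1) with (- (x * x / (1 + x * x))) by (field; nra).
    rewrite Rabs_Ropp, Rabs_pos_eq by (apply Rdiv_le_0_compat; nra).
    apply Rle_div_l; [nra|].
    assert (0 <= x * (1 - x + x * x)) by (apply Rmult_le_pos; nra). nra.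
Qed.

Lemma riesz_kernel_bounds (b x : R) : 0 <= b -> 0 <= x -> 0 <= riesz_kernel b x <= 1.
Proof. intros Hb Hx. split; [apply pw_ge0|apply pw_le_1; lra]. Qed.

Lemma kernel_bound_riesz (b : R) : 0 < b -> kernel_bound (2 + b) (riesz_kernel b).
Proof.
  intros Hb x Hx. pose proof (riesz_kernel_bounds b x (Rlt_le _ _ Hb) Hx) as Hr.
  rewrite riesz_kernel_0, Rabs_minus_sym, !Rabs_pos_eq by lra. split.
  - destruct (Rle_dec x 1) as [|Hx1]; [nra|].
    unfold riesz_kernel. rewrite pw_nonpos by lra. lra.
  - enough (1 - (1 + b) * x <= riesz_kernel b x) by lra.
    apply Rle_trans with (pw (1 - x) (1 + b)); [apply pw_one_minus_ge; lra|].
    destruct (Rle_dec x 1) as [Hx1|Hx1].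
    + rewrite pw_pred by lra. replace (1 + b - 1) with b by ring. unfold riesz_kernel in *. nra.
    + rewrite pw_nonpos by lra. apply Hr.
Qed.

Lemma kernel_bound_young_dilated (k : R) : 1 <= k -> kernel_bound 2 (fun x => young k (k * x)).
Proof.
  intros Hk x Hx. assert (Hkx : 0 <= k * x) by (apply Rmult_le_pos; lra).
  rewrite Rmult_0_r, young_0. split.
  - pose proof (young_le_1 k (k * x) Hk Hkx). pose proof (young_decay k (k * x) Hk Hkx).
    pose proof (Rabs_pos (young k (k * x))). nra.
  - eapply Rle_trans; [now apply young_minus_1_le|]. apply Rle_div_l; nra.
Qed.

Lemma is_kernel_young (k : R) : 1 <= k -> is_kernel (young k).
Proof.
  intros Hk. destruct (is_kernel_dilate (/ k) (fun x => young k (k * x))) as [B HB].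
  - apply Rinv_0_lt_compat. lra.
  - exists 2. now apply kernel_bound_young_dilated.
  - exists B. intros x Hx. specialize (HB x Hx). cbv beta in HB.
    rewrite Rmult_0_r, Rmult_0_r in HB.
    now replace (k * (/ k * x)) with x in HB by (field; lra).
Qed.

Lemma abel_minus_riesz_dilated (b x : R) : 1 <= b -> 0 <= x ->
  0 <= abel_kernel x - riesz_kernel b (/ b * x) <= x * x * abel_kernel x / b.
Proof.
  intros Hb Hx. unfold abel_kernel, riesz_kernel.
  set (z := / b * x). assert (Ez : b * z = x) by (unfold z; field; lra).
  assert (Hz : 0 <= z) by (apply Rmult_le_pos; [left; apply Rinv_0_lt_compat|]; lra).
  assert (Hexp : forall y, pw (exp (- y)) b = exp (- (b * y))).
  { intros y. rewrite pw_exp. f_equal. ring. }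
  clearbody z. subst x. rewrite <- Hexp. split.
  - enough (pw (1 - z) b <= pw (exp (- z)) b) by lra.
    apply pw_le_l; [|lra]. pose proof (exp_ineq1_le (- z)). lra.
  - replace (b * z * (b * z) * pw (exp (- z)) b / b) with (b * (z * z) * pw (exp (- z)) b)
      by (field; lra).
    enough ((1 - b * (z * z)) * pw (exp (- z)) b <= pw (1 - z) b) by lra.
    apply Rle_trans with (pw (1 - z * z) b * pw (exp (- z)) b).
    + apply Rmult_le_compat_r; [apply pw_ge0|]. apply pw_one_minus_ge; nra.
    + (* [1 - z^2 = (1 - z) (1 + z)] and [1 + z <= exp z] *)
      rewrite <- pw_mult by apply exp_pos. destruct (Rle_dec z 1) as [Hz1|Hz1].
      * apply pw_le_l; [|lra]. pose proof (abel_kernel_le_inv z Hz) as He.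
        unfold abel_kernel in He.
        replace ((1 - z * z) * exp (- z)) with ((1 - z) * (exp (- z) * (1 + z))) by ring.
        rewrite <- (Rmult_1_r (1 - z)) at 2. apply Rmult_le_compat_l; lra.
      * assert (0 <= (z * z - 1) * exp (- z)).
        { apply Rmult_le_pos; [nra|left; apply exp_pos]. }
        rewrite !pw_nonpos; lra.
Qed.

Lemma sqr_mult_abel_kernel_le (x : R) : 0 <= x -> x * x * abel_kernel x <= 4.
Proof.
  intros Hx. unfold abel_kernel. pose proof (abel_kernel_le_inv (x / 2) ltac:(lra)) as H.
  unfold abel_kernel in H. pose proof (exp_pos (- (x / 2))) as Hpos.
  replace (- x) with (- (x / 2) + - (x / 2)) by field. rewrite exp_plus.
  set (e := exp (- (x / 2))) in *. assert (Hex : 0 <= x * e <= 2) by nra.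
  replace (x * x * (e * e)) with (x * e * (x * e)) by ring. nra.
Qed.

Inductive classical_kernel : (R -> R) -> Prop :=
| young_classical (k : R) : 1 <= k -> classical_kernel (young k)
| riesz_classical (b : R) : 0 < b -> classical_kernel (riesz_kernel b)
| abel_classical : classical_kernel abel_kernel.

Lemma is_kernel_classical (phi : R -> R) : classical_kernel phi -> is_kernel phi.
Proof.
  intros [k Hk|b Hb|].
  - now apply is_kernel_young.
  - exists (2 + b). now apply kernel_bound_riesz.
  - exists 1. exact kernel_bound_abel.
Qed.

Lemma continuity_pt_classical (phi : R -> R) :
  classical_kernel phi -> forall x, 0 < x -> continuity_pt phi x.
Proof.
  intros [k Hk|b Hb|] x Hx.
  - now apply continuity_pt_young.
  - apply (continuity_pt_comp (fun x => 1 - x) (fun y => pw y b)).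
    + apply continuity_pt_of_is_derive with (- 1). auto_derive; [trivial|ring].
    + apply continuity_pt_pw. lra.
  - apply continuity_pt_of_is_derive with (- exp (- x)). unfold abel_kernel.
    auto_derive; [trivial|ring].
Qed.

(** * Bernstein polynomials *)

Fixpoint binomial_mean (n : nat) (t : R) (g : nat -> R) : R :=
  match n with
  | O => g O
  | S n' => t * binomial_mean n' t (fun k => g (S k)) + (1 - t) * binomial_mean n' t g
  end.

Definition bernstein (n : nat) (f : R -> R) (t : R) : R :=
  binomial_mean n t (fun k => f (INR k / INR n)).

Lemma binomial_mean_le (n : nat) (t : R) (g g' : nat -> R) :
  0 <= t <= 1 -> (forall k, (k <= n)%nat -> g k <= g' k) ->
  binomial_mean n t g <= binomial_mean n t g'.
Proof.
  intros Ht. revert g g'. induction n as [|n IH]; intros g g' H; simpl.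
  - now apply H.
  - apply Rplus_le_compat; apply Rmult_le_compat_l; try lra; apply IH;
      intros k Hk; apply H; lia.
Qed.

Lemma binomial_mean_ext (n : nat) (t : R) (g g' : nat -> R) :
  (forall k, g k = g' k) -> binomial_mean n t g = binomial_mean n t g'.
Proof.
  revert g g'. induction n as [|n IH]; intros g g' H; simpl; [apply H|].
  rewrite (IH (fun k => g (S k)) (fun k => g' (S k))), (IH g g'); auto.
Qed.

Lemma binomial_mean_1 (n : nat) (g : nat -> R) : binomial_mean n 1 g = g n.
Proof.
  revert g. induction n as [|n IH]; intros g; simpl; [reflexivity|].
  rewrite !IH. ring.
Qed.

Lemma binomial_mean_quadratic (n : nat) (t a b c : R) :
  binomial_mean n t (fun k => a + b * INR k + c * INR k ^ 2) =
  a + b * (INR n * t) + c * (INR n * t * (1 - t) + (INR n * t) ^ 2).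
Proof.
  revert a b c. induction n as [|n IH]; intros a b c; [simpl; ring|].
  cbn [binomial_mean]. rewrite IH.
  rewrite (binomial_mean_ext n t _
    (fun k => (a + b + c) + (b + 2 * c) * INR k + c * INR k ^ 2)).
  - rewrite IH, S_INR. ring.
  - intros k. rewrite S_INR. ring.
Qed.

Lemma bernstein_le (n : nat) (f g : R -> R) (t : R) :
  (0 < n)%nat -> 0 <= t <= 1 -> (forall s, 0 <= s <= 1 -> f s <= g s) ->
  bernstein n f t <= bernstein n g t.
Proof.
  intros Hn Ht H. apply lt_INR in Hn. simpl in Hn.
  apply binomial_mean_le; [exact Ht|]. intros k Hk. apply H. pose proof (pos_INR k). split.
  - apply Rdiv_le_0_compat; lra.
  - apply Rle_div_l; [lra|]. rewrite Rmult_1_l. now apply le_INR.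
Qed.

Lemma bernstein_1 (n : nat) (f : R -> R) : (0 < n)%nat -> bernstein n f 1 = f 1.
Proof.
  intros Hn. apply lt_INR in Hn. simpl in Hn. unfold bernstein. rewrite binomial_mean_1.
  f_equal. field. lra.
Qed.

Lemma bernstein_quadratic (n : nat) (t a b c : R) : (0 < n)%nat ->
  bernstein n (fun s => a + b * s + c * s ^ 2) t = a + b * t + c * (t ^ 2 + t * (1 - t) / INR n).
Proof.
  intros Hn. apply lt_INR in Hn. simpl in Hn. unfold bernstein.
  rewrite (binomial_mean_ext n t _
    (fun k => a + b / INR n * INR k + c / INR n ^ 2 * INR k ^ 2)).
  - rewrite binomial_mean_quadratic. field. lra.
  - intros k. field. lra.
Qed.

Lemma Rabs_bernstein_minus_le (n : nat) (f : R -> R) (y t a b c : R) :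
  (0 < n)%nat -> 0 <= t <= 1 ->
  (forall s, 0 <= s <= 1 -> Rabs (f s - y) <= a + b * s + c * s ^ 2) ->
  Rabs (bernstein n f t - y) <= a + b * t + c * (t ^ 2 + t * (1 - t) / INR n).
Proof.
  intros Hn Ht H.
  pose proof (bernstein_le n f (fun s => (y + a) + b * s + c * s ^ 2) t Hn Ht) as Hupper.
  pose proof (bernstein_le n (fun s => (y - a) + - b * s + - c * s ^ 2) f t Hn Ht) as Hlower.
  rewrite bernstein_quadratic in Hupper, Hlower by exact Hn.
  apply Rabs_le. split.
  - enough (y - a + - b * t + - c * (t ^ 2 + t * (1 - t) / INR n) <= bernstein n f t) by lra.
    apply Hlower. intros s Hs. specialize (H s Hs). apply Rabs_le_between in H. lra.
  - enough (bernstein n f t <= y + a + b * t + c * (t ^ 2 + t * (1 - t) / INR n)) by lra.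
    apply Hupper. intros s Hs. specialize (H s Hs). apply Rabs_le_between in H. lra.
Qed.

Lemma quadratic_modulus (f : R -> R) (eps : R) :
  (forall t, 0 <= t <= 1 -> continuity_pt f t) -> 0 < eps ->
  exists K, 0 <= K /\ forall s t, 0 <= s <= 1 -> 0 <= t <= 1 ->
    Rabs (f s - f t) <= eps + K * (s - t) ^ 2.
Proof.
  intros Cf Heps.
  destruct (Heine_cor2 Cf (mkposreal eps Heps)) as [d Hd].
  destruct (bounded_continuity (V := R_NormedModule) f 0 1) as [M HM].
  { intros t Ht. now apply continuity_pt_filterlim, Cf. }
  assert (HM0 : 0 < M) by (eapply Rle_lt_trans; [apply (Rabs_pos (f 0))|apply (HM 0); lra]).
  pose proof (cond_pos d) as Hd0. exists (2 * M / (d * d)).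
  assert (HK : 0 <= 2 * M / (d * d)) by (apply Rdiv_le_0_compat; nra).
  split; [exact HK|]. intros s t Hs Ht.
  destruct (Rlt_dec (Rabs (s - t)) d) as [Hst|Hst].
  - specialize (Hd s t Hs Ht Hst). simpl in Hd. pose proof (pow2_ge_0 (s - t)). nra.
  - pose proof (HM s Hs : Rabs (f s) < M). pose proof (HM t Ht : Rabs (f t) < M).
    assert (Hfar : Rabs (f s - f t) <= 2 * M).
    { eapply Rle_trans; [apply Rabs_triang|]. rewrite Rabs_Ropp. lra. }
    enough (2 * M <= 2 * M / (d * d) * (s - t) ^ 2) by lra.
    replace (2 * M / (d * d) * (s - t) ^ 2) with (2 * M * (s - t) ^ 2 / (d * d)) by (field; lra).
    apply -> Rle_div_r; [|nra]. apply Rmult_le_compat_l; [lra|].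
    rewrite <- (pow2_abs (s - t)). nra.
Qed.

Lemma bernstein_approx (f : R -> R) (eps : R) :
  (forall t, 0 <= t <= 1 -> continuity_pt f t) -> 0 < eps ->
  exists n, (0 < n)%nat /\ forall t, 0 <= t <= 1 -> Rabs (f t - bernstein n f t) <= eps.
Proof.
  intros Cf Heps. destruct (quadratic_modulus f (eps / 2) Cf ltac:(lra)) as (K & HK & Hmod).
  destruct (INR_unbounded (2 * K / eps)) as [n Hn].
  exists (S n). split; [lia|]. intros t Ht. rewrite Rabs_minus_sym.
  assert (HSn : 2 * K <= INR (S n) * eps).
  { apply Rlt_div_l in Hn; [|lra]. rewrite S_INR. lra. }
  assert (HSn0 : 0 < INR (S n)) by (apply lt_0_INR; lia).
  eapply Rle_trans.
  - apply (Rabs_bernstein_minus_le (S n) f (f t) t (eps / 2 + K * t ^ 2) (- 2 * K * t) K);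
      [lia|exact Ht|].
    intros s Hs. eapply Rle_trans; [now apply Hmod|]. right. ring.
  - replace (eps / 2 + K * t ^ 2 + - 2 * K * t * t + K * (t ^ 2 + t * (1 - t) / INR (S n))) with
      (eps / 2 + K * (t * (1 - t)) / INR (S n)) by (field; lra).
    enough (K * (t * (1 - t)) / INR (S n) <= eps / 2) by lra.
    apply Rle_div_l; [exact HSn0|]. nra.
Qed.

(** * Bernstein approximation of kernels *)

Definition concave_along (u g : R -> R) (g_infty : R) : Prop :=
  forall x, 0 < x -> exists a b,
    g x = a + b * u x /\ g_infty <= a /\ forall y, 0 <= y -> g y <= a + b * u y.

(* [u] is a coordinate on [0, oo] with values in [0, 1]; [delta] and [rho] are, up to constants, the
   largest values a kernel, respectively its distance to its value at [0], can take.  Bernstein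
   polynomials in [u] preserve bounds by functions which are concave in [u]. *)
Record kernel_coordinate (u inv delta rho : R -> R) : Prop := {
  coordinate_0 : u 0 = 1;
  coordinate_bounds : forall x, 0 < x -> 0 < u x < 1;
  coordinate_decreasing : forall x y, 0 <= x <= y -> u y <= u x;
  coordinate_inv : forall t, 0 < t < 1 -> 0 < inv t /\ u (inv t) = t;
  coordinate_inv_continuous : forall t, 0 < t < 1 -> continuity_pt inv t;
  inv_coordinate : forall x, 0 < x -> inv (u x) = x;
  delta_concave : concave_along u delta 0;
  delta_bounds : forall x, 0 <= x -> 1 <= delta x * (1 + x) <= 4;
  rho_concave : concave_along u rho 1;
  rho_bounds : forall x, 0 <= x -> x <= rho x * (1 + x) /\ rho x <= x }.

Arguments coordinate_0 {u inv delta rho}.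
Arguments coordinate_bounds {u inv delta rho}.
Arguments coordinate_decreasing {u inv delta rho}.
Arguments coordinate_inv {u inv delta rho}.
Arguments coordinate_inv_continuous {u inv delta rho}.
Arguments inv_coordinate {u inv delta rho}.
Arguments delta_concave {u inv delta rho}.
Arguments delta_bounds {u inv delta rho}.
Arguments rho_concave {u inv delta rho}.
Arguments rho_bounds {u inv delta rho}.

(* [1 / (4 - ln t)] is a concave function of [t = exp (- y)], written with [a = 4 + y]. *)
Lemma inv_le_exp_tangent (a b : R) : 4 <= a -> 4 <= b ->
  / a <= / b + / b * / b * (exp (b - a) - 1).
Proof.
  intros Ha Hb. set (d := b - a). set (e := exp d - 1).
  enough (Hle : d * b <= a * e).
  { apply Rmult_le_reg_l with (a * (b * b)); [repeat apply Rmult_lt_0_compat; lra|].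
    replace (a * (b * b) * / a) with (b * b) by (field; lra).
    replace (a * (b * b) * (/ b + / b * / b * e)) with (a * b + a * e) by (field; lra).
    replace b with (a + d) at 1 by (unfold d; ring). lra. }
  destruct (Rle_dec (- 2) d) as [Hd|Hd].
  - assert (He : d + d * d / 4 <= e).
    { unfold e. replace (exp d) with (exp (d / 2) * exp (d / 2))
        by (rewrite <- exp_plus; f_equal; field).
      pose proof (exp_ineq1_le (d / 2)). nra. }
    apply Rle_trans with (a * (d + d * d / 4)); [|apply Rmult_le_compat_l; lra].
    replace b with (a + d) by (unfold d; ring). nra.
  - assert (He : - 1 < e) by (unfold e; pose proof (exp_pos d); lra).
    apply Rle_trans with (a * - 1); [|apply Rmult_le_compat_l; lra].
    replace a with (b - d) by (unfold d; ring). nra.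
Qed.

Lemma kernel_coordinate_abel :
  kernel_coordinate abel_kernel (fun t => - ln t) (fun x => 4 / (4 + x))
    (fun x => 1 - abel_kernel x).
Proof.
  constructor; unfold abel_kernel.
  - now rewrite Ropp_0, exp_0.
  - intros x Hx. split; [apply exp_pos|]. rewrite <- exp_0. apply exp_increasing. lra.
  - intros x y Hxy. apply exp_le. lra.
  - intros t Ht. rewrite Ropp_involutive, exp_ln by lra. split; [|reflexivity].
    enough (ln t < ln 1) by (rewrite ln_1 in *; lra). apply ln_increasing; lra.
  - intros t Ht. apply continuity_pt_of_is_derive with (- / t). auto_derive; [lra|]. field. lra.
  - intros x Hx. rewrite ln_exp. ring.
  - intros x Hx. set (r := / (4 + x)).
    assert (Hr : 0 < r) by (apply Rinv_0_lt_compat; lra).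
    assert (Er : r * (4 + x) = 1) by (apply Rinv_l; lra).
    exists (4 * (r - r * r)), (4 * (r * r) * exp x).
    assert (Hexp : forall y, exp x * exp (- y) = exp (4 + x - (4 + y))).
    { intros y. rewrite <- exp_plus. f_equal. ring. }
    repeat split.
    + rewrite Rmult_assoc, Hexp, Rminus_diag, exp_0. unfold Rdiv. fold r. ring.
    + nra.
    + intros y Hy. rewrite Rmult_assoc, Hexp.
      pose proof (inv_le_exp_tangent (4 + y) (4 + x) ltac:(lra) ltac:(lra)) as Htan.
      fold r in Htan. unfold Rdiv. lra.
  - intros x Hx. split.
    + replace (4 / (4 + x) * (1 + x)) with (4 * (1 + x) / (4 + x)) by (field; lra).
      apply Rle_div_r; lra.
    + replace (4 / (4 + x) * (1 + x)) with (4 * (1 + x) / (4 + x)) by (field; lra).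
      apply Rle_div_l; lra.
  - intros x Hx. exists 1, (- 1). split; [ring|]. split; [lra|]. intros y Hy. lra.
  - intros x Hx. pose proof (abel_kernel_le_inv x Hx) as H. unfold abel_kernel in H.
    pose proof (exp_ineq1_le (- x)). lra.
Qed.

Lemma sqrt_le_tangent (r y : R) : 0 < r -> 0 <= y -> sqrt y <= r / 2 + / (2 * r) * y.
Proof.
  intros Hr Hy. pose proof (sqrt_sqrt y Hy). set (s := sqrt y) in *.
  replace (r / 2 + / (2 * r) * y) with ((r * r + y) / (2 * r)) by (field; lra).
  apply Rle_div_r; [lra|]. pose proof (Rle_0_sqr (r - s)). unfold Rsqr in *. nra.
Qed.

Lemma cauchy_kernel_pos (x : R) : 0 < cauchy_kernel x.
Proof. apply Rinv_0_lt_compat. nra. Qed.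

Lemma cauchy_kernel_bounds (x : R) : 0 < x -> 0 < cauchy_kernel x < 1.
Proof.
  intros Hx. split; [apply cauchy_kernel_pos|]. unfold cauchy_kernel.
  rewrite <- Rinv_1 at 2. apply Rinv_lt_contravar; nra.
Qed.

Lemma one_minus_cauchy_kernel (x : R) : 1 - cauchy_kernel x = x * x * cauchy_kernel x.
Proof. unfold cauchy_kernel. field. nra. Qed.

Lemma sqrt_cauchy_kernel_bounds (x : R) : 0 <= x ->
  1 <= sqrt (cauchy_kernel x) * (1 + x) <= 2 /\ sqrt (cauchy_kernel x) <= 1.
Proof.
  intros Hx. pose proof (cauchy_kernel_pos x) as Hv.
  pose proof (one_minus_cauchy_kernel x) as E. pose proof (sqrt_pos (cauchy_kernel x)) as Hs.
  pose proof (sqrt_sqrt (cauchy_kernel x) ltac:(lra)) as Es.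
  set (s := sqrt (cauchy_kernel x)) in *. rewrite <- Es in E. clearbody s.
  assert (Hp : 0 <= s * x) by nra. replace (s * (1 + x)) with (s + s * x) by ring.
  set (p := s * x) in *. assert (Esp : s * s + p * p = 1) by (unfold p; lra).
  clearbody p.
  assert (Hs1 : s <= 1) by nra. assert (Hp1 : p <= 1) by nra. repeat split; nra.
Qed.

Lemma kernel_coordinate_cauchy :
  kernel_coordinate cauchy_kernel (fun t => sqrt (/ t - 1)) (fun x => sqrt (cauchy_kernel x))
    (fun x => sqrt (1 - cauchy_kernel x)).
Proof.
  constructor.
  - apply cauchy_kernel_0.
  - apply cauchy_kernel_bounds.
  - intros x y Hxy. apply Rinv_le_contravar; nra.
  - intros t Ht. assert (Hi : 1 < / t) by (rewrite <- Rinv_1; apply Rinv_lt_contravar; lra).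
    split; [apply sqrt_lt_R0; lra|]. unfold cauchy_kernel.
    rewrite sqrt_sqrt by lra. field. lra.
  - intros t Ht. assert (Hi : 1 < / t) by (rewrite <- Rinv_1; apply Rinv_lt_contravar; lra).
    apply (continuity_pt_comp (fun t => / t - 1) sqrt).
    + apply continuity_pt_of_is_derive with (- / (t * t)). auto_derive; [lra|]. field. lra.
    + apply continuity_pt_sqrt. lra.
  - intros x Hx. unfold cauchy_kernel. rewrite Rinv_inv.
    replace (1 + x * x - 1) with (x * x) by ring. apply sqrt_square. lra.
  - intros x Hx. pose proof (cauchy_kernel_bounds x Hx) as Hu.
    set (r := sqrt (cauchy_kernel x)). assert (Hr : 0 < r) by (apply sqrt_lt_R0; lra).
    exists (r / 2), (/ (2 * r)). repeat split.
    + rewrite <- (sqrt_sqrt (cauchy_kernel x)) by lra. fold r. field. lra.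
    + lra.
    + intros y Hy. apply sqrt_le_tangent; [exact Hr|]. left. apply Rinv_0_lt_compat. nra.
  - intros x Hx. pose proof (sqrt_cauchy_kernel_bounds x Hx). lra.
  - intros x Hx. pose proof (cauchy_kernel_bounds x Hx) as Hu.
    set (r := sqrt (1 - cauchy_kernel x)). assert (Hr : 0 < r) by (apply sqrt_lt_R0; lra).
    exists (r / 2 + / (2 * r)), (- / (2 * r)). repeat split.
    + replace (cauchy_kernel x) with (1 - r * r) by (unfold r; rewrite sqrt_sqrt; lra).
      field. lra.
    + pose proof (sqrt_le_tangent r 1 Hr Rle_0_1) as Htan. rewrite sqrt_1 in Htan. lra.
    + intros y Hy.
      assert (Hy1 : 0 <= 1 - cauchy_kernel y).
      { rewrite one_minus_cauchy_kernel. pose proof (cauchy_kernel_pos y). nra. }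
      pose proof (sqrt_le_tangent r (1 - cauchy_kernel y) Hr Hy1). lra.
  - intros x Hx. pose proof (cauchy_kernel_pos x).
    rewrite one_minus_cauchy_kernel, sqrt_mult, sqrt_square by nra.
    pose proof (sqrt_cauchy_kernel_bounds x Hx). nra.
Qed.

Section Coordinate.

Context (u inv delta rho : R -> R).
Context (Hu : kernel_coordinate u inv delta rho).

Lemma coordinate_surjective (t : R) : 0 < t <= 1 -> exists x, 0 <= x /\ u x = t.
Proof.
  intros [Ht0 [Ht1| ->]].
  - destruct (coordinate_inv Hu t (conj Ht0 Ht1)) as [Hi E]. exists (inv t). lra.
  - exists 0. split; [lra|apply (coordinate_0 Hu)].
Qed.

Lemma Rabs_kernel_le_delta (B x : R) (phi : R -> R) :
  kernel_bound B phi -> 0 <= x -> Rabs (phi x) <= B * delta x.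
Proof.
  intros HB Hx. destruct (HB x Hx) as [H _]. pose proof (kernel_bound_ge0 _ _ HB).
  pose proof (delta_bounds Hu x Hx).
  apply Rmult_le_reg_r with (1 + x); [lra|]. rewrite Rmult_assoc. nra.
Qed.

Lemma Rabs_kernel_minus_le_rho (B x : R) (phi : R -> R) :
  kernel_bound B phi -> 0 <= x -> Rabs (phi x - phi 0) <= 3 * B * rho x.
Proof.
  intros HB Hx. destruct (HB x Hx) as [H1 H2]. destruct (HB 0 (Rle_refl 0)) as [H0 _].
  pose proof (kernel_bound_ge0 _ _ HB). destruct (rho_bounds Hu x Hx) as [Hrho _].
  assert (Htriang : Rabs (phi x - phi 0) <= Rabs (phi x) + Rabs (phi 0)).
  { rewrite <- (Rabs_Ropp (phi 0)). apply Rabs_triang. }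
  apply Rmult_le_reg_r with (1 + x); [lra|]. apply Rle_trans with (3 * B * x); [|nra].
  pose proof (Rabs_pos (phi x)). nra.
Qed.

Lemma inv_gt (x t : R) : 0 < x -> 0 < t < u x -> x < inv t.
Proof.
  intros Hx Ht. pose proof (coordinate_bounds Hu x Hx).
  destruct (coordinate_inv Hu t ltac:(lra)) as [Hi Ei]. apply Rnot_le_lt. intros Hle.
  pose proof (coordinate_decreasing Hu (inv t) x ltac:(lra)). lra.
Qed.

Lemma inv_lt (x t : R) : 0 < x -> u x < t < 1 -> 0 < inv t < x.
Proof.
  intros Hx Ht. pose proof (coordinate_bounds Hu x Hx).
  destruct (coordinate_inv Hu t ltac:(lra)) as [Hi Ei].
  split; [exact Hi|]. apply Rnot_le_lt. intros Hle.
  pose proof (coordinate_decreasing Hu x (inv t) ltac:(lra)). lra.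
Qed.

Lemma exists_kernel_in_coordinate (B : R) (phi : R -> R) :
  kernel_bound B phi -> (forall x, 0 < x -> continuity_pt phi x) ->
  exists f, continuity f /\ f 0 = 0 /\ forall x, 0 <= x -> f (u x) = phi x.
Proof.
  intros HB Cphi. pose proof (kernel_bound_ge0 _ _ HB) as HB0.
  destruct (C0_extension_lt (T := R_UniformSpace) (fun t => phi (inv t)) 0 (phi 0) 0 1)
    as (f & Cf & Ef & E0 & E1).
  - lra.
  - intros t Ht. apply (proj1 (continuity_pt_filterlim (fun t => phi (inv t)) t)).
    apply (continuity_pt_comp inv phi).
    + now apply (coordinate_inv_continuous Hu).
    + now apply Cphi, (coordinate_inv Hu).
  - apply (filterlim_locally (U := R_UniformSpace)). intros eps. pose proof (cond_pos eps).
    set (A := (B + 1) / eps). assert (HA : 0 < A) by (apply Rdiv_lt_0_compat; lra).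
    destruct (coordinate_bounds Hu A HA) as [HuA0 HuA1].
    unfold at_right, within. apply (filter_imp (fun t => t < u A)); [|exact (open_lt (u A) 0 HuA0)].
    intros t HtA Ht. pose proof (inv_gt A t HA (conj Ht HtA)) as HiA.
    destruct (HB (inv t) ltac:(lra)) as [Hphi _]. change (Rabs (phi (inv t) - 0) < eps).
    rewrite Rminus_0_r. apply Rmult_lt_reg_r with A; [exact HA|].
    replace (eps * A) with (B + 1) by (unfold A; field; lra).
    pose proof (Rabs_pos (phi (inv t))). nra.
  - apply (filterlim_locally (U := R_UniformSpace)). intros eps. pose proof (cond_pos eps).
    set (d := eps / (B + 1)). assert (Hd : 0 < d) by (apply Rdiv_lt_0_compat; lra).
    destruct (coordinate_bounds Hu d Hd) as [Hud0 Hud1].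
    unfold at_left, within. apply (filter_imp (fun t => u d < t)); [|exact (open_gt (u d) 1 Hud1)].
    intros t Htd Ht. pose proof (inv_lt d t Hd (conj Htd Ht)) as Hid.
    destruct (HB (inv t) ltac:(lra)) as [_ Hphi]. change (Rabs (phi (inv t) - phi 0) < eps).
    assert (Ed : (B + 1) * d = eps) by (unfold d; field; lra). nra.
  - exists f. split; [intros t; apply continuity_pt_filterlim, Cf|]. split; [exact E0|].
    intros x [Hx|<-].
    + rewrite Ef by now apply (coordinate_bounds Hu).
      now rewrite (inv_coordinate Hu).
    + now rewrite (coordinate_0 Hu).
Qed.

Lemma Rabs_bernstein_le_concave (n : nat) (f g : R -> R) (g_infty K y x : R) :
  (0 < n)%nat -> concave_along u g g_infty -> 0 <= K ->
  Rabs (f 0 - y) <= K * g_infty ->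
  (forall z, 0 <= z -> Rabs (f (u z) - y) <= K * g z) ->
  0 < x -> Rabs (bernstein n f (u x) - y) <= K * g x.
Proof.
  intros Hn Hg HK Hinfty Hfin Hx. destruct (Hg x Hx) as (a & b & -> & Ha & Hab).
  replace (K * (a + b * u x)) with
    (K * a + K * b * u x + 0 * (u x ^ 2 + u x * (1 - u x) / INR n)) by ring.
  pose proof (coordinate_bounds Hu x Hx).
  apply Rabs_bernstein_minus_le; [exact Hn|lra|]. intros s [[Hs|<-] Hs1].
  - destruct (coordinate_surjective s (conj Hs Hs1)) as (z & Hz & <-).
    eapply Rle_trans; [now apply Hfin|].
    pose proof (Rmult_le_compat_l K _ _ HK (Hab z Hz)). lra.
  - eapply Rle_trans; [exact Hinfty|]. nra.
Qed.

Lemma kernel_bound_bernstein (n : nat) (B : R) (f phi : R -> R) :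
  (0 < n)%nat -> kernel_bound B phi -> f 0 = 0 -> (forall x, 0 <= x -> f (u x) = phi x) ->
  kernel_bound (4 * B) (fun x => bernstein n f (u x)).
Proof.
  intros Hn HB f0 Hf. pose proof (kernel_bound_ge0 _ _ HB) as HB0.
  destruct (HB 0 (Rle_refl 0)) as [H0 _].
  pose proof (coordinate_0 Hu) as u0.
  assert (f1 : bernstein n f 1 = phi 0) by (rewrite bernstein_1, <- u0, Hf; [reflexivity|lra|lia]).
  intros x [Hx|<-]; cbv beta; rewrite u0, f1; [|rewrite Rminus_diag, Rabs_R0; lra].
  pose proof (delta_bounds Hu x (Rlt_le _ _ Hx)) as Hdelta.
  destruct (rho_bounds Hu x (Rlt_le _ _ Hx)) as [_ Hrho]. split.
  - assert (Hle : Rabs (bernstein n f (u x) - 0) <= B * delta x).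
    { apply (Rabs_bernstein_le_concave n f delta 0 B); auto.
      - exact (delta_concave Hu).
      - rewrite f0, Rminus_0_r, Rabs_R0. lra.
      - intros z Hz. rewrite Rminus_0_r, Hf by exact Hz. now apply Rabs_kernel_le_delta. }
    rewrite Rminus_0_r in Hle. apply Rle_trans with (B * delta x * (1 + x)); [|nra].
    apply Rmult_le_compat_r; lra.
  - apply Rle_trans with (3 * B * rho x); [|nra].
    apply (Rabs_bernstein_le_concave n f rho 1); auto.
    + exact (rho_concave Hu).
    + lra.
    + rewrite f0, Rminus_0_l, Rabs_Ropp. lra.
    + intros z Hz. rewrite Hf by exact Hz. now apply Rabs_kernel_minus_le_rho.
Qed.

End Coordinate.

(** * Summation by parts *)

Lemma ex_series_of_bounded (u : nat -> R) (K : R) :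
  (forall n, 0 <= u n) -> (forall n, sum_n u n <= K) -> ex_series u.
Proof.
  intros H0 HK. destruct (ex_finite_lim_seq_incr (sum_n u) K) as [s Hs].
  - intros n. rewrite sum_Sn. unfold plus; simpl. specialize (H0 (S n)). lra.
  - exact HK.
  - exists s. exact Hs.
Qed.

Lemma Series_le_of_bounded (u : nat -> R) (K : R) :
  (forall n, 0 <= u n) -> (forall n, sum_n u n <= K) -> Series u <= K.
Proof.
  intros H0 HK. pose proof (Series_correct u (ex_series_of_bounded u K H0 HK)) as Hlim.
  exact (is_lim_seq_le _ _ _ _ HK (Hlim : is_lim_seq (sum_n u) (Series u)) (is_lim_seq_const K)).
Qed.

Lemma ex_series_dominated (u v : nat -> R) :
  (forall n, Rabs (u n) <= v n) -> ex_series v -> ex_series u.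
Proof.
  exact (ex_series_le (K := R_AbsRing) (V := R_CompleteNormedModule) u v).
Qed.

Lemma Rabs_Series_le (u v : nat -> R) :
  (forall n, Rabs (u n) <= v n) -> ex_series v -> Rabs (Series u) <= Series v.
Proof.
  intros H Ev. eapply Rle_trans.
  - apply Series_Rabs, (ex_series_dominated _ v); [|exact Ev].
    intros n. now rewrite Rabs_Rabsolu.
  - apply Series_le; [|exact Ev]. intros n. split; [apply Rabs_pos|apply H].
Qed.

Lemma Rabs_Series_minus_sum_n_le (u v : nat -> R) (N : nat) :
  (forall n, Rabs (u n) <= v n) -> ex_series v ->
  Rabs (Series u - sum_n u N) <= Series v - sum_n v N.
Proof.
  intros H Ev. pose proof (ex_series_dominated u v H Ev) as Eu.
  assert (Etail : forall w, ex_series w ->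
            Series w - sum_n w N = Series (fun k => w (S N + k)%nat)).
  { intros w Ew. rewrite (Series_incr_n w (S N)), sum_n_Reals by (auto; lia). simpl pred. ring. }
  rewrite !Etail by assumption. apply Rabs_Series_le; [intros n; apply H|].
  now apply ex_series_incr_n.
Qed.

Lemma summation_by_parts_le (d E w Q : nat -> R) :
  (forall n, sum_n d n <= E n) -> (forall n, 0 <= w (S n) <= w n) ->
  E O * w O <= Q O -> (forall n, (E (S n) - E n) * w (S n) <= Q (S n) - Q n) ->
  forall n, sum_n (fun k => d k * w k) n <= Q n.
Proof.
  intros HE Hw H0 HS.
  assert (Hw0 : forall n, 0 <= w n) by (intros n; specialize (Hw n); lra).
  enough (Hn : forall n, sum_n (fun k => d k * w k) n + (E n - sum_n d n) * w n <= Q n).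
  { intros n. specialize (Hn n). specialize (HE n). specialize (Hw0 n). nra. }
  induction n as [|n IH]; [rewrite !sum_O; lra|].
  rewrite !sum_Sn. unfold plus; simpl. specialize (HS n). specialize (HE n). specialize (Hw n).
  nra.
Qed.

(* Of the order of [sqrt (min (x, 1 / x))], the geometric mean of a uniform bound and of the bound
   for a kernel vanishing at [0]. *)
Definition weight (x : R) : R := sqrt x / (1 + x).

Lemma weight_ge0 (x : R) : 0 <= x -> 0 <= weight x.
Proof. intros Hx. apply Rdiv_le_0_compat; [apply sqrt_pos|lra]. Qed.

Lemma le_sqrt_mult_weight (B eps e x : R) : 0 <= x -> 0 <= eps -> 0 <= e ->
  e <= eps -> e * (1 + x) <= B -> e <= B * x -> e <= sqrt (4 * B * eps) * weight x.
Proof.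
  intros Hx Heps He Hsmall Hdecay Hzero. unfold weight.
  assert (HB : 0 <= B) by nra.
  assert (Hbound : e * ((1 + x) * (1 + x)) <= 4 * B * x).
  { destruct (Rle_dec x 1); [|nra].
    apply Rle_trans with (e * 4); [apply Rmult_le_compat_l; nra|lra]. }
  replace (sqrt (4 * B * eps) * (sqrt x / (1 + x))) with (sqrt (4 * B * eps) * sqrt x / (1 + x))
    by (field; lra).
  apply -> Rle_div_r; [|lra]. rewrite <- sqrt_mult by nra.
  rewrite <- (sqrt_square (e * (1 + x))) by nra. apply sqrt_le_1_alt.
  replace (e * (1 + x) * (e * (1 + x))) with (e * ((1 + x) * (1 + x)) * e) by ring.
  replace (4 * B * eps * x) with (4 * B * x * eps) by ring.
  apply Rmult_le_compat; nra.
Qed.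

Lemma weight_le_shift (x y : R) : 0 <= x <= y -> y <= x + 1 -> weight x <= 2 * weight y.
Proof.
  intros Hxy Hyx. unfold weight. pose proof (sqrt_le_1_alt x y (proj2 Hxy)) as Hs.
  pose proof (sqrt_pos x). apply Rle_div_l; [lra|].
  replace (2 * (sqrt y / (1 + y)) * (1 + x)) with (sqrt y * (2 * (1 + x)) / (1 + y))
    by (field; lra).
  apply -> Rle_div_r; [|lra]. apply Rmult_le_compat; lra.
Qed.

Lemma weight_telescope (s t : R) : 0 <= s <= t -> 0 < t ->
  (t * t - s * s) * / (t * (1 + t * t)) <= 4 * (t / (1 + t) - s / (1 + s)).
Proof.
  intros Hst Ht.
  replace (4 * (t / (1 + t) - s / (1 + s))) with ((t - s) * (4 / ((1 + t) * (1 + s))))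
    by (field; lra).
  replace ((t * t - s * s) * / (t * (1 + t * t))) with ((t - s) * ((t + s) / (t * (1 + t * t))))
    by (field; nra).
  apply Rmult_le_compat_l; [lra|]. apply Rle_trans with (2 / (1 + t * t)).
  - apply Rle_div_l; [nra|]. replace (2 / (1 + t * t) * (t * (1 + t * t))) with (2 * t)
      by (field; nra). lra.
  - apply Rle_div_l; [nra|].
    replace (4 / ((1 + t) * (1 + s)) * (1 + t * t)) with (4 * (1 + t * t) / ((1 + t) * (1 + s)))
      by (field; lra).
    apply -> Rle_div_r; [|nra]. pose proof (Rle_0_sqr (1 - t)). unfold Rsqr in *. nra.
Qed.

(** * Averages with respect to powers *)

Lemma filterlim_at_right_0_iff (f : R -> R) (y : R) :
  filterlim f (at_right 0) (locally y) <->
  forall eps, 0 < eps -> exists d, 0 < d /\ forall h, 0 < h < d -> Rabs (f h - y) < eps.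
Proof.
  rewrite (filterlim_locally (U := R_UniformSpace)). split.
  - intros H eps Heps. destruct (H (mkposreal eps Heps)) as [d Hd].
    exists d. split; [apply cond_pos|]. intros h Hh. apply (Hd h); [|apply Hh].
    change (Rabs (h - 0) < d). rewrite Rminus_0_r, Rabs_pos_eq; lra.
  - intros H eps. destruct (H eps (cond_pos eps)) as (d & Hd & Hf).
    exists (mkposreal d Hd). intros h Hh Hh0. apply Hf.
    change (Rabs (h - 0) < d) in Hh. rewrite Rminus_0_r, Rabs_pos_eq in Hh; lra.
Qed.

Lemma at_right_0_pos : at_right 0 (fun h => 0 < h).
Proof. unfold at_right, within. now apply filter_forall. Qed.

Lemma exists_large_of_succ (P : R -> Prop) (k K : R) :
  (forall j, k <= j -> P j -> P (j + 1)) -> P k -> exists j, K <= j /\ k <= j /\ P j.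
Proof.
  intros Hsucc Hk. destruct (INR_unbounded (K - k)) as [n Hn].
  exists (k + INR n). pose proof (pos_INR n). split; [lra|]. split; [lra|]. clear Hn.
  induction n as [|n IH]; [now rewrite Rplus_0_r|].
  rewrite S_INR, <- Rplus_assoc. pose proof (pos_INR n).
  apply Hsucc; [lra|]. now apply IH.
Qed.

Lemma Rpower_small (e eta : R) : 0 < e -> 0 < eta ->
  exists d, 0 < d /\ forall h, 0 < h < d -> Rpower h e < eta.
Proof.
  intros He Heta. destruct (continuity_pt_pw 0 e (Rlt_le _ _ He) eta Heta) as (d & Hd & Hpw).
  exists d. split; [exact Hd|]. intros h Hh.
  specialize (Hpw h). simpl in Hpw. unfold R_dist in Hpw.
  rewrite (pw_nonpos 0), !Rminus_0_r, !Rabs_pos_eq in Hpw by (try apply pw_ge0; lra).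
  rewrite <- pw_Rpower by lra. apply Hpw. repeat split; lra.
Qed.

Lemma Rpower_mult_opp (h p : R) : Rpower h p * Rpower h (- p) = 1.
Proof.
  rewrite <- Rpower_plus, Rplus_opp_r. unfold Rpower. now rewrite Rmult_0_l, exp_0.
Qed.

Definition power_increments_le (m : R -> R) (p L eta d : R) : Prop :=
  forall h1 h2, 0 < h1 <= h2 -> h2 < d ->
    Rabs (Rpower h2 p * (m h2 - L) - Rpower h1 p * (m h1 - L)) <=
    eta * (Rabs p / p * (Rpower h2 p - Rpower h1 p)).

Lemma eventually_close_of_power_increments_neg (m : R -> R) (p L eta d : R) :
  p < 0 -> 0 < d -> 0 < eta ->
  power_increments_le m p L eta d ->
  exists d', 0 < d' /\ forall h, 0 < h < d' -> Rabs (m h - L) < 2 * eta.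
Proof.
  intros Hp Hd Heta Hincr.
  set (K := Rpower (d / 2) p * Rabs (m (d / 2) - L)).
  assert (HK : 0 <= K) by (apply Rmult_le_pos; [left; apply exp_pos|apply Rabs_pos]).
  destruct (Rpower_small (- p) (eta / (K + 1))) as (d' & Hd' & Hsmall).
  { lra. }
  { apply Rdiv_lt_0_compat; lra. }
  exists (Rmin d' (d / 2)). split; [apply Rmin_pos; lra|]. intros h Hh.
  pose proof (Rmin_l d' (d / 2)). pose proof (Rmin_r d' (d / 2)).
  specialize (Hsmall h ltac:(lra)). specialize (Hincr h (d / 2) ltac:(lra) ltac:(lra)).
  rewrite (Rabs_left p) in Hincr by exact Hp. replace (- p / p) with (- 1) in Hincr by (field; lra).
  pose proof (Rpower_mult_opp h p) as Einv.
  assert (Hq : 0 < Rpower h (- p)) by apply exp_pos. assert (Hr : 0 < Rpower h p) by apply exp_pos.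
  assert (Hr2 : 0 < Rpower (d / 2) p) by apply exp_pos.
  set (q := Rpower h (- p)) in *. set (r := Rpower h p) in *.
  assert (Hmain : r * Rabs (m h - L) <= eta * r + K).
  { unfold K. rewrite <- (Rabs_pos_eq r) at 1 by lra.
    rewrite <- (Rabs_pos_eq (Rpower (d / 2) p)) at 1 by lra. rewrite <- !Rabs_mult.
    pose proof (Rabs_triang_inv (r * (m h - L)) (Rpower (d / 2) p * (m (d / 2) - L))) as Htri.
    rewrite Rabs_minus_sym in Htri. nra. }
  apply Rmult_le_compat_l with (r := q) in Hmain; [|lra].
  assert (HqK : q * (K + 1) < eta) by (apply Rlt_div_r; lra).
  replace (q * (r * Rabs (m h - L))) with (r * q * Rabs (m h - L)) in Hmain by ring.
  replace (q * (eta * r + K)) with (eta * (r * q) + q * K) in Hmain by ring.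
  rewrite Einv in Hmain. lra.
Qed.

Lemma eventually_close_of_power_increments_pos (m : R -> R) (p L eta d K : R) :
  1 < p -> 0 < d -> 0 < eta ->
  (forall h, 0 < h -> Rabs (m h) <= K * (1 + / h)) ->
  power_increments_le m p L eta d ->
  exists d', 0 < d' /\ forall h, 0 < h < d' -> Rabs (m h - L) < 2 * eta.
Proof.
  intros Hp Hd Heta HK Hincr. exists d. split; [exact Hd|]. intros h Hh.
  assert (HK0 : 0 <= K).
  { pose proof (HK 1 Rlt_0_1) as H. rewrite Rinv_1 in H. pose proof (Rabs_pos (m 1)). lra. }
  set (C := 2 * K + Rabs L). assert (HC : 0 <= C) by (unfold C; pose proof (Rabs_pos L); lra).
  assert (Hr : 0 < Rpower h p) by apply exp_pos. set (r := Rpower h p) in *.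
  destruct (Rpower_small (p - 1) (eta * r / (C + 1))) as (d' & Hd' & Hsmall).
  { lra. }
  { apply Rdiv_lt_0_compat; nra. }
  set (h1 := Rmin (d' / 2) (Rmin h 1)).
  assert (Hh1 : 0 < h1) by (repeat apply Rmin_pos; lra).
  assert (Hh1le : h1 <= d' / 2 /\ h1 <= h /\ h1 <= 1).
  { unfold h1. pose proof (Rmin_l (d' / 2) (Rmin h 1)). pose proof (Rmin_r (d' / 2) (Rmin h 1)).
    pose proof (Rmin_l h 1). pose proof (Rmin_r h 1). lra. }
  specialize (Hsmall h1 ltac:(lra)). specialize (Hincr h1 h ltac:(lra) ltac:(lra)).
  rewrite (Rabs_pos_eq p) in Hincr by lra. replace (p / p) with 1 in Hincr by (field; lra).
  assert (Hq : 0 < Rpower h1 (p - 1)) by apply exp_pos.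
  assert (Eq : Rpower h1 p = Rpower h1 (p - 1) * h1).
  { rewrite <- (Rpower_1 h1) at 3 by exact Hh1. rewrite <- Rpower_plus. f_equal. ring. }
  fold r in Hincr. rewrite Eq in Hincr. set (q := Rpower h1 (p - 1)) in *.
  assert (Hqh1 : 0 < q * h1) by now apply Rmult_lt_0_compat.
  assert (Hfirst : q * h1 * Rabs (m h1 - L) <= q * C).
  { rewrite Rmult_assoc. apply Rmult_le_compat_l; [lra|].
    apply Rle_trans with (h1 * (K * (1 + / h1) + Rabs L)).
    - apply Rmult_le_compat_l; [lra|]. eapply Rle_trans; [apply Rabs_triang|].
      rewrite Rabs_Ropp. apply Rplus_le_compat_r, HK, Hh1.
    - replace (h1 * (K * (1 + / h1) + Rabs L)) with (h1 * (K + Rabs L) + K) by (field; lra).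
      unfold C. pose proof (Rabs_pos L). nra. }
  assert (HqC : q * (C + 1) < eta * r) by (apply Rlt_div_r; lra).
  apply Rmult_lt_reg_l with r; [exact Hr|].
  pose proof (Rabs_triang_inv (r * (m h - L)) (q * h1 * (m h1 - L))) as Htri.
  rewrite (Rabs_mult r), (Rabs_mult (q * h1)), (Rabs_pos_eq r), (Rabs_pos_eq (q * h1))
    in Htri by lra.
  assert (0 < eta * (q * h1)) by (apply Rmult_lt_0_compat; lra). lra.
Qed.

(** * Kernel means of a series *)

Section Means.

Context (lam a : nat -> R) (l : R).
Context (lam_ge0 : forall n, 0 <= lam n).
Context (lam_incr : forall n, lam n <= lam (S n)).
Context (M : R).
Context (abs_sum_le : forall n, sum_n (fun k => (1 + lam k) * Rabs (a k)) n <= M * (1 + lam n)).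

Lemma sum_bound_ge0 : 0 <= M.
Proof.
  pose proof (abs_sum_le 0) as H. rewrite sum_O in H.
  pose proof (lam_ge0 0). pose proof (Rabs_pos (a 0%nat)). nra.
Qed.

Lemma shifted_weighted_sum_le (h : R) (n : nat) : 0 < h ->
  sum_n (fun k => Rabs (a k) * weight ((1 + lam k) * h)) n <= 4 * M.
Proof.
  intros Hh. pose proof sum_bound_ge0 as HM0.
  set (t := fun k => sqrt ((1 + lam k) * h)).
  set (q := fun k => / (t k * (1 + t k * t k))).
  assert (Ht : forall k, 0 < t k).
  { intros k. specialize (lam_ge0 k). apply sqrt_lt_R0. nra. }
  assert (Et : forall k, t k * t k = (1 + lam k) * h).
  { intros k. specialize (lam_ge0 k). apply sqrt_sqrt. nra. }
  assert (Hincr : forall k, t k <= t (S k)).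
  { intros k. specialize (lam_incr k). apply sqrt_le_1_alt. nra. }
  assert (Eterm : forall k, Rabs (a k) * weight ((1 + lam k) * h) = t k * t k * Rabs (a k) * q k).
  { intros k. unfold weight, q. fold (t k). rewrite <- Et. specialize (Ht k). field. nra. }
  rewrite (sum_n_ext _ _ n Eterm).
  apply Rle_trans with (4 * M * (t n / (1 + t n))).
  - apply (summation_by_parts_le (fun k => t k * t k * Rabs (a k)) (fun k => M * (t k * t k)) q
      (fun k => 4 * M * (t k / (1 + t k)))).
    + intros k. rewrite Et, (sum_n_ext _ (fun j => mult h ((1 + lam j) * Rabs (a j)))).
      * rewrite (sum_n_mult_l (K := R_Ring) h). unfold mult; simpl.
        rewrite Rmult_comm, <- Rmult_assoc. apply Rmult_le_compat_r; [lra|apply abs_sum_le].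
      * intros j. rewrite Et. unfold mult; simpl. ring.
    + intros k. pose proof (Ht k). specialize (Hincr k). split.
      * left. apply Rinv_0_lt_compat. specialize (Ht (S k)). nra.
      * apply Rinv_le_contravar; [nra|]. apply Rmult_le_compat; nra.
    + pose proof (weight_telescope 0 (t 0%nat)) as Htel. specialize (Ht 0%nat).
      fold (q 0%nat) in Htel.
      apply Rmult_le_compat_l with (r := M) in Htel; [|exact HM0|lra..].
      unfold Rdiv in Htel at 2. lra.
    + intros k. specialize (Hincr k). pose proof (Ht k).
      pose proof (weight_telescope (t k) (t (S k)) ltac:(lra) (Ht (S k))) as Htel.
      fold (q (S k)) in Htel. apply Rmult_le_compat_l with (r := M) in Htel; [|exact HM0]. lra.
  - rewrite <- (Rmult_1_r (4 * M)) at 2. apply Rmult_le_compat_l; [lra|].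
    specialize (Ht n). apply Rle_div_l; lra.
Qed.

Lemma ex_series_abs_over_1_plus : ex_series (fun n => Rabs (a n) / (1 + lam n)).
Proof.
  apply (ex_series_dominated _ (fun n => 2 * (Rabs (a n) * weight ((1 + lam n) * 1)))).
  - intros n. specialize (lam_ge0 n). rewrite Rmult_1_r. unfold weight.
    rewrite Rabs_pos_eq by (apply Rdiv_le_0_compat; [apply Rabs_pos|lra]).
    set (y := 1 + lam n). assert (Hy : 1 <= y) by (unfold y; lra).
    assert (Hs : 1 <= sqrt y) by (rewrite <- sqrt_1; apply sqrt_le_1_alt; exact Hy).
    replace (2 * (Rabs (a n) * (sqrt y / (1 + y)))) with (Rabs (a n) * (2 * sqrt y / (1 + y)))
      by (field; lra).
    apply Rmult_le_compat_l; [apply Rabs_pos|]. rewrite <- (Rmult_1_l (/ y)).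
    apply Rle_div_l; [lra|].
    replace (2 * sqrt y / (1 + y) * y) with (2 * sqrt y * y / (1 + y)) by (field; lra).
    apply -> Rle_div_r; [|lra]. nra.
  - apply (ex_series_scal (K := R_AbsRing) (V := R_NormedModule) 2
      (fun n => Rabs (a n) * weight ((1 + lam n) * 1))).
    apply (ex_series_of_bounded _ (4 * M)).
    + intros n. specialize (lam_ge0 n). apply Rmult_le_pos; [apply Rabs_pos|apply weight_ge0; lra].
    + intros n. apply shifted_weighted_sum_le. lra.
Qed.

Lemma weighted_sum_le (h : R) (n : nat) : 0 < h <= 1 ->
  sum_n (fun k => Rabs (a k) * weight (lam k * h)) n <= 8 * M.
Proof.
  intros Hh. apply Rle_trans with (2 * sum_n (fun k => Rabs (a k) * weight ((1 + lam k) * h)) n).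
  - rewrite <- (sum_n_mult_l (K := R_Ring) 2). apply sum_n_m_le. intros k.
    specialize (lam_ge0 k). unfold mult; simpl.
    rewrite (Rmult_comm 2), Rmult_assoc, (Rmult_comm _ 2).
    apply Rmult_le_compat_l; [apply Rabs_pos|]. apply weight_le_shift; nra.
  - pose proof (shifted_weighted_sum_le h n (proj1 Hh)). lra.
Qed.

Definition kernel_mean (phi : R -> R) (h : R) : R := Series (fun n => a n * phi (lam n * h)).

Definition series_abs_over_1_plus : R := Series (fun n => Rabs (a n) / (1 + lam n)).

Lemma kernel_term_le (phi : R -> R) (B h : R) (n : nat) : 0 < h -> kernel_bound B phi ->
  Rabs (a n * phi (lam n * h)) <= B * (1 + / h) * (Rabs (a n) / (1 + lam n)).
Proof.
  intros Hh HB. pose proof (lam_ge0 n) as Hlam. pose proof (kernel_bound_ge0 _ _ HB) as HB0.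
  assert (Hlh : 0 <= lam n * h) by nra. destruct (HB _ Hlh) as [Hphi _].
  assert (Hi : 0 < / h) by now apply Rinv_0_lt_compat.
  assert (Ei : lam n * h * / h = lam n) by (field; lra).
  rewrite Rabs_mult.
  replace (B * (1 + / h) * (Rabs (a n) / (1 + lam n))) with
    (Rabs (a n) * (B * (1 + / h) / (1 + lam n))) by (field; lra).
  apply Rmult_le_compat_l; [apply Rabs_pos|]. apply -> Rle_div_r; [|lra].
  set (f := Rabs (phi (lam n * h))) in *. assert (Hf : 0 <= f) by apply Rabs_pos.
  apply Rle_trans with (f * ((1 + lam n * h) * (1 + / h))); [|nra].
  apply Rmult_le_compat_l; [exact Hf|].
  replace ((1 + lam n * h) * (1 + / h)) with (1 + lam n + / h + lam n * h)
    by (rewrite <- Ei at 1; ring). lra.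
Qed.

Lemma ex_series_kernel_bound_terms (B h : R) :
  ex_series (fun n => B * (1 + / h) * (Rabs (a n) / (1 + lam n))).
Proof.
  apply (ex_series_scal (K := R_AbsRing) (V := R_NormedModule) (B * (1 + / h))
    (fun n => Rabs (a n) / (1 + lam n))), ex_series_abs_over_1_plus.
Qed.

Lemma ex_series_kernel (phi : R -> R) (h : R) :
  is_kernel phi -> 0 < h -> ex_series (fun n => a n * phi (lam n * h)).
Proof.
  intros [B HB] Hh.
  apply (ex_series_dominated _ (fun n => B * (1 + / h) * (Rabs (a n) / (1 + lam n)))).
  - intros n. now apply kernel_term_le.
  - apply ex_series_kernel_bound_terms.
Qed.

Lemma Rabs_kernel_mean_le (phi : R -> R) (B h : R) :
  kernel_bound B phi -> 0 < h -> Rabs (kernel_mean phi h) <= B * series_abs_over_1_plus * (1 + / h).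
Proof.
  intros HB Hh. rewrite Rmult_assoc, (Rmult_comm series_abs_over_1_plus), <- Rmult_assoc.
  unfold series_abs_over_1_plus. rewrite <- Series_scal_l.
  apply Rabs_Series_le; [|apply ex_series_kernel_bound_terms].
  intros n. now apply kernel_term_le.
Qed.

Definition tail_abs_over_1_plus (N : nat) : R :=
  series_abs_over_1_plus - sum_n (fun n => Rabs (a n) / (1 + lam n)) N.

Lemma tail_abs_over_1_plus_ge0 (N : nat) : 0 <= tail_abs_over_1_plus N.
Proof.
  eapply Rle_trans; [apply Rabs_pos|].
  apply (Rabs_Series_minus_sum_n_le (fun n => Rabs (a n) / (1 + lam n))).
  - intros n. specialize (lam_ge0 n). rewrite Rabs_pos_eq; [lra|].
    apply Rdiv_le_0_compat; [apply Rabs_pos|lra].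
  - exact ex_series_abs_over_1_plus.
Qed.

Lemma is_lim_seq_tail_abs_over_1_plus : is_lim_seq tail_abs_over_1_plus 0.
Proof.
  rewrite <- (Rminus_diag series_abs_over_1_plus).
  apply is_lim_seq_minus'; [apply is_lim_seq_const|].
  exact (Series_correct _ ex_series_abs_over_1_plus).
Qed.

Lemma Rabs_kernel_mean_minus_sum_n_le (phi : R -> R) (B h : R) (N : nat) :
  kernel_bound B phi -> 0 < h ->
  Rabs (kernel_mean phi h - sum_n (fun n => a n * phi (lam n * h)) N) <=
  B * (1 + / h) * tail_abs_over_1_plus N.
Proof.
  intros HB Hh. unfold tail_abs_over_1_plus, series_abs_over_1_plus.
  rewrite Rmult_minus_distr_l, <- Series_scal_l.
  rewrite <- (sum_n_mult_l (K := R_Ring) (B * (1 + / h))).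
  apply (Rabs_Series_minus_sum_n_le _ (fun n => B * (1 + / h) * (Rabs (a n) / (1 + lam n))));
    [|apply ex_series_kernel_bound_terms].
  intros n. now apply kernel_term_le.
Qed.

Definition kernel_sums (phi : R -> R) : Prop :=
  is_kernel phi /\ filterlim (kernel_mean phi) (at_right 0) (locally (phi 0 * l)).

Lemma kernel_sums_ext (phi psi : R -> R) :
  (forall x, 0 <= x -> phi x = psi x) -> kernel_sums phi -> kernel_sums psi.
Proof.
  intros E [[B HB] L]. split.
  - exists B. intros x Hx. rewrite <- !E by lra. now apply HB.
  - rewrite <- E by lra. apply (filterlim_ext_loc (kernel_mean phi)); [|exact L].
    apply (filter_imp (fun h => 0 < h)); [|exact at_right_0_pos].
    intros h Hh. apply Series_ext. intros n. specialize (lam_ge0 n). rewrite E; [reflexivity|nra].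
Qed.

Lemma kernel_sums_plus (phi psi : R -> R) :
  kernel_sums phi -> kernel_sums psi -> kernel_sums (fun x => phi x + psi x).
Proof.
  intros [K1 L1] [K2 L2]. split.
  - destruct K1 as [B1 H1], K2 as [B2 H2]. exists (B1 + B2). now apply kernel_bound_plus.
  - rewrite Rmult_plus_distr_r.
    apply (filterlim_ext_loc (fun h => plus (kernel_mean phi h) (kernel_mean psi h))).
    + apply (filter_imp (fun h => 0 < h)); [|exact at_right_0_pos].
      intros h Hh. unfold kernel_mean, plus; simpl.
      rewrite <- Series_plus by now apply ex_series_kernel.
      apply Series_ext. intros n. ring.
    + apply (filterlim_comp_2 _ _ plus L1 L2 (filterlim_plus (V := R_NormedModule) _ _)).
Qed.

Lemma kernel_sums_scal (c : R) (phi : R -> R) :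
  kernel_sums phi -> kernel_sums (fun x => c * phi x).
Proof.
  intros [[B HB] L]. split.
  - exists (Rabs c * B). now apply kernel_bound_scal.
  - rewrite Rmult_assoc. apply (filterlim_ext (fun h => scal c (kernel_mean phi h))).
    + intros h. unfold kernel_mean, scal; simpl; unfold mult; simpl.
      rewrite <- Series_scal_l. apply Series_ext. intros n. ring.
    + eapply filterlim_comp; [exact L|]. apply (filterlim_scal_r (V := R_NormedModule) c).
Qed.

Lemma kernel_sums_dilate (s : R) (phi : R -> R) :
  0 < s -> kernel_sums phi -> kernel_sums (fun x => phi (s * x)).
Proof.
  intros Hs [K L]. split; [now apply is_kernel_dilate|]. rewrite Rmult_0_r.
  apply (filterlim_ext (fun h => kernel_mean phi (s * h))).
  - intros h. apply Series_ext. intros n. do 2 f_equal. ring.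
  - rewrite filterlim_at_right_0_iff in L |- *. intros eps Heps.
    destruct (L eps Heps) as (d & Hd & Hl). exists (d / s).
    split; [now apply Rdiv_lt_0_compat|]. intros h [Hh Hhd].
    apply Hl. apply Rlt_div_r in Hhd; [nra|exact Hs].
Qed.

Lemma kernel_sums_minus (phi psi : R -> R) :
  kernel_sums phi -> kernel_sums psi -> kernel_sums (fun x => phi x - psi x).
Proof.
  intros Hphi Hpsi. apply (kernel_sums_ext (fun x => phi x + - 1 * psi x)).
  - intros x _. ring.
  - apply kernel_sums_plus; [exact Hphi|]. now apply kernel_sums_scal.
Qed.

Lemma Rabs_kernel_mean_le_of_small (phi : R -> R) (B eps h : R) :
  0 <= eps -> 0 < h <= 1 -> kernel_bound B phi -> phi 0 = 0 ->
  (forall x, 0 <= x -> Rabs (phi x) <= eps) ->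
  Rabs (kernel_mean phi h) <= sqrt (4 * B * eps) * (8 * M).
Proof.
  intros Heps Hh HB H0 Hsmall.
  assert (Hpos : forall n, 0 <= Rabs (a n) * weight (lam n * h)).
  { intros n. specialize (lam_ge0 n). apply Rmult_le_pos; [apply Rabs_pos|].
    apply weight_ge0. nra. }
  assert (Hsum : forall n, sum_n (fun k => Rabs (a k) * weight (lam k * h)) n <= 8 * M)
    by (intros n; now apply weighted_sum_le).
  apply Rle_trans with (Series (fun n => sqrt (4 * B * eps) * (Rabs (a n) * weight (lam n * h)))).
  - apply Rabs_Series_le.
    + intros n. specialize (lam_ge0 n). rewrite Rabs_mult, <- Rmult_assoc, (Rmult_comm (sqrt _)).
      rewrite Rmult_assoc. apply Rmult_le_compat_l; [apply Rabs_pos|].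
      assert (Hlh : 0 <= lam n * h) by nra. destruct (HB _ Hlh) as [Hdecay Hzero].
      rewrite H0, Rminus_0_r in Hzero.
      apply le_sqrt_mult_weight; auto. apply Rabs_pos.
    + apply (ex_series_scal (K := R_AbsRing) (V := R_NormedModule) (sqrt (4 * B * eps))
        (fun n => Rabs (a n) * weight (lam n * h))).
      now apply (ex_series_of_bounded _ (8 * M)).
  - rewrite Series_scal_l. apply Rmult_le_compat_l; [apply sqrt_pos|].
    now apply Series_le_of_bounded.
Qed.

Lemma kernel_sums_uniform_limit (B : R) (phi : R -> R) :
  (forall eps, 0 < eps -> exists psi, kernel_sums psi /\ phi 0 = psi 0 /\
     kernel_bound B (fun x => phi x - psi x) /\
     forall x, 0 <= x -> Rabs (phi x - psi x) <= eps) ->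
  kernel_sums phi.
Proof.
  intros Happ.
  assert (Kphi : is_kernel phi).
  { destruct (Happ 1 Rlt_0_1) as (psi & [[B' HB'] _] & _ & HB & _). exists (B + B').
    intros x Hx. pose proof (kernel_bound_plus _ _ _ _ HB HB' x Hx) as H. cbv beta in H.
    replace (phi x - psi x + psi x) with (phi x) in H by ring.
    now replace (phi 0 - psi 0 + psi 0) with (phi 0) in H by ring. }
  split; [exact Kphi|]. apply filterlim_at_right_0_iff. intros eps Heps.
  pose proof sum_bound_ge0 as HM0.
  assert (HB0 : 0 <= B).
  { destruct (Happ 1 Rlt_0_1) as (psi & _ & _ & HB & _). exact (kernel_bound_ge0 _ _ HB). }
  set (r := eps / (2 * (8 * M + 1))). assert (Hr : 0 < r) by (apply Rdiv_lt_0_compat; lra).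
  set (eta := r * r / (4 * B + 1)). assert (Heta : 0 < eta) by (apply Rdiv_lt_0_compat; nra).
  assert (Hsqrt : sqrt (4 * B * eta) <= r).
  { rewrite <- (sqrt_square r) by lra. apply sqrt_le_1_alt.
    assert (Eeta : (4 * B + 1) * eta = r * r) by (unfold eta; field; lra). lra. }
  destruct (Happ eta Heta) as (psi & [Kpsi Lpsi] & E0 & HB & Hsmall).
  destruct (proj1 (filterlim_at_right_0_iff _ _) Lpsi (eps / 2) ltac:(lra)) as (d & Hd & Hpsi).
  exists (Rmin d 1). split; [apply Rmin_pos; lra|]. intros h Hh.
  pose proof (Rmin_l d 1). pose proof (Rmin_r d 1). specialize (Hpsi h ltac:(lra)).
  assert (Hdiff : Rabs (kernel_mean phi h - kernel_mean psi h) <= eps / 2).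
  { unfold kernel_mean at 1 2. rewrite <- Series_minus by (apply ex_series_kernel; auto; lra).
    rewrite (Series_ext _ (fun n => a n * (phi (lam n * h) - psi (lam n * h))))
      by (intros n; ring).
    eapply Rle_trans.
    - apply (Rabs_kernel_mean_le_of_small (fun x => phi x - psi x) B eta); auto; lra.
    - apply Rle_trans with (r * (8 * M)); [apply Rmult_le_compat_r; lra|].
      apply Rle_trans with (r * (8 * M + 1)); [nra|]. right. unfold r. field. lra. }
  replace (kernel_mean phi h - phi 0 * l) with
    ((kernel_mean phi h - kernel_mean psi h) + (kernel_mean psi h - psi 0 * l))
    by (rewrite E0; ring).
  eapply Rle_lt_trans; [apply Rabs_triang|]. lra.
Qed.

Lemma kernel_sums_pow_mult_binomial_mean (u : R -> R) :
  (forall k, kernel_sums (fun x => u x ^ S k)) ->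
  forall n j g, kernel_sums (fun x => u x ^ S j * binomial_mean n (u x) g).
Proof.
  intros Hpow. induction n as [|n IH]; intros j g.
  - apply (kernel_sums_ext (fun x => g O * u x ^ S j)); [intros; simpl; ring|].
    now apply kernel_sums_scal.
  - apply (kernel_sums_ext (fun x =>
      u x ^ S (S j) * binomial_mean n (u x) (fun k => g (S k)) +
      (u x ^ S j * binomial_mean n (u x) g - u x ^ S (S j) * binomial_mean n (u x) g))).
    + intros; simpl; ring.
    + apply kernel_sums_plus; [apply IH|]. apply kernel_sums_minus; apply IH.
Qed.

Lemma kernel_sums_binomial_mean (u : R -> R) :
  (forall k, kernel_sums (fun x => u x ^ S k)) ->
  forall n g, g O = 0 -> kernel_sums (fun x => binomial_mean n (u x) g).
Proof.
  intros Hpow n. pose proof (kernel_sums_pow_mult_binomial_mean u Hpow) as Hmult.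
  induction n as [|n IH]; intros g Hg.
  - apply (kernel_sums_ext (fun x => 0 * u x ^ 1)); [intros; simpl; rewrite Hg; ring|].
    now apply kernel_sums_scal.
  - apply (kernel_sums_ext (fun x =>
      u x ^ 1 * binomial_mean n (u x) (fun k => g (S k)) +
      (binomial_mean n (u x) g - u x ^ 1 * binomial_mean n (u x) g))).
    + intros; simpl; ring.
    + apply kernel_sums_plus; [apply Hmult|].
      apply kernel_sums_minus; [now apply IH|apply Hmult].
Qed.

Lemma kernel_sums_of_coordinate_powers (u inv delta rho phi : R -> R) :
  kernel_coordinate u inv delta rho -> (forall k, kernel_sums (fun x => u x ^ S k)) ->
  is_kernel phi -> (forall x, 0 < x -> continuity_pt phi x) -> kernel_sums phi.
Proof.
  intros Hu Hpow [B HB] Cphi.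
  destruct (exists_kernel_in_coordinate u inv delta rho Hu B phi HB Cphi) as (f & Cf & f0 & Hf).
  apply (kernel_sums_uniform_limit (B + 4 * B)). intros eps Heps.
  destruct (bernstein_approx f eps (fun t _ => Cf t) Heps) as (n & Hn & Happrox).
  exists (fun x => bernstein n f (u x)). split; [|split; [|split]].
  - apply kernel_sums_binomial_mean; [exact Hpow|]. simpl. unfold Rdiv. now rewrite Rmult_0_l.
  - now rewrite (coordinate_0 Hu), bernstein_1, <- (coordinate_0 Hu), Hf
      by (try apply Rle_refl; assumption).
  - apply kernel_bound_minus; [exact HB|].
    exact (kernel_bound_bernstein u inv delta rho Hu n B f phi Hn HB f0 Hf).
  - intros x Hx. rewrite <- Hf by exact Hx. apply Happrox. destruct Hx as [Hx|<-].
    + pose proof (coordinate_bounds Hu x Hx). lra.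
    + rewrite (coordinate_0 Hu). lra.
Qed.

Lemma kernel_sums_of_abel (phi : R -> R) :
  kernel_sums abel_kernel -> is_kernel phi -> (forall x, 0 < x -> continuity_pt phi x) ->
  kernel_sums phi.
Proof.
  intros Habel. apply (kernel_sums_of_coordinate_powers _ _ _ _ _ kernel_coordinate_abel).
  intros k. apply (kernel_sums_ext (fun x => abel_kernel (INR (S k) * x))).
  - intros x _. unfold abel_kernel. induction (S k) as [|j IH].
    + now rewrite Rmult_0_l, Ropp_0, exp_0.
    + simpl pow. rewrite <- IH, <- exp_plus, S_INR. f_equal. ring.
  - apply kernel_sums_dilate; [apply lt_0_INR; lia|exact Habel].
Qed.

Lemma cauchy_kernel_dilate (b x : R) : 0 <= b ->
  cauchy_kernel (sqrt b * x) = / (1 + b * (x * x)).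
Proof.
  intros Hb. unfold cauchy_kernel. f_equal.
  replace (sqrt b * x * (sqrt b * x)) with (sqrt b * sqrt b * (x * x)) by ring.
  now rewrite sqrt_sqrt.
Qed.

Lemma cauchy_kernel_minus_dilate (b x : R) : 0 <= b ->
  cauchy_kernel x - cauchy_kernel (sqrt b * x) =
  (b - 1) * (x * x * cauchy_kernel x * cauchy_kernel (sqrt b * x)).
Proof.
  intros Hb. rewrite cauchy_kernel_dilate by exact Hb. unfold cauchy_kernel. field.
  split; nra.
Qed.

Lemma cauchy_pow_minus_bounds (k : nat) (b x : R) : 1 <= b ->
  0 <= cauchy_kernel x ^ S k - cauchy_kernel x ^ k * cauchy_kernel (sqrt b * x) <=
    (b - 1) * (x * x * cauchy_kernel x * cauchy_kernel x).
Proof.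
  intros Hb. pose proof (cauchy_kernel_minus_dilate b x ltac:(lra)) as Ediff.
  pose proof (cauchy_kernel_pos x). pose proof (cauchy_kernel_pos (sqrt b * x)).
  pose proof (one_minus_cauchy_kernel x) as E1.
  set (v := cauchy_kernel x) in *. set (w := cauchy_kernel (sqrt b * x)) in *.
  replace (v ^ S k - v ^ k * w) with (v ^ k * (v - w)) by (simpl; ring).
  assert (Hxv : 0 <= x * x * v) by nra.
  assert (Hvk : 0 <= v ^ k <= 1).
  { split; [apply pow_le; lra|]. rewrite <- (pow1 k). apply pow_incr. lra. }
  assert (Hdiff : 0 <= v - w).
  { rewrite Ediff. apply Rmult_le_pos; [lra|]. now apply Rmult_le_pos, Rlt_le. }
  split; [now apply Rmult_le_pos|].
  apply Rle_trans with (v - w); [nra|]. rewrite Ediff.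
  apply Rmult_le_compat_l; [lra|]. apply Rmult_le_compat_l; lra.
Qed.

Lemma cauchy_kernel_le_1 (x : R) : cauchy_kernel x <= 1.
Proof.
  pose proof (cauchy_kernel_pos x). pose proof (one_minus_cauchy_kernel x). nra.
Qed.

Lemma sqr_mult_cauchy_kernel_bounds (x : R) : 0 <= x ->
  0 <= x * x * cauchy_kernel x * cauchy_kernel x <= cauchy_kernel x /\
  x * x * cauchy_kernel x * cauchy_kernel x <= x.
Proof.
  intros Hx. pose proof (cauchy_kernel_pos x) as Hv. pose proof (cauchy_kernel_le_1 x) as Hv1.
  pose proof (one_minus_cauchy_kernel x) as E. set (v := cauchy_kernel x) in *.
  assert (Hxxv : 0 <= x * x * v <= 1) by lra.
  assert (Hxv : x * v <= 1) by nra.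
  repeat split; [nra|nra|]. replace (x * x * v * v) with (x * (x * v * v)) by ring.
  assert (x * v * v <= 1) by nra. nra.
Qed.

Lemma kernel_sums_cauchy_pow_of_mult (k : nat) :
  (forall b, 1 < b -> kernel_sums (fun x => cauchy_kernel x ^ k * cauchy_kernel (sqrt b * x))) ->
  kernel_sums (fun x => cauchy_kernel x ^ S k).
Proof.
  intros Hmult. apply (kernel_sums_uniform_limit 2). intros eps Heps.
  set (d := Rmin eps 1). assert (Hd : 0 < d) by (apply Rmin_pos; lra).
  assert (Hd1 : d <= eps /\ d <= 1) by (split; [apply Rmin_l|apply Rmin_r]).
  exists (fun x => cauchy_kernel x ^ k * cauchy_kernel (sqrt (1 + d) * x)).
  assert (E0 : cauchy_kernel 0 ^ S k = cauchy_kernel 0 ^ k * cauchy_kernel (sqrt (1 + d) * 0))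
    by (rewrite Rmult_0_r; simpl; ring).
  split; [apply Hmult; lra|]. split; [exact E0|].
  assert (Hbounds : forall x, 0 <= x ->
    0 <= cauchy_kernel x ^ S k - cauchy_kernel x ^ k * cauchy_kernel (sqrt (1 + d) * x)
      <= d * (x * x * cauchy_kernel x * cauchy_kernel x)).
  { intros x Hx. pose proof (cauchy_pow_minus_bounds k (1 + d) x ltac:(lra)) as H.
    now replace (1 + d - 1) with d in H by ring. }
  split; intros x Hx; specialize (Hbounds x Hx);
    destruct (sqr_mult_cauchy_kernel_bounds x Hx) as [Hv Hvx];
    set (e := cauchy_kernel x ^ S k - _) in *;
    set (g := x * x * cauchy_kernel x * cauchy_kernel x) in *.
  - rewrite E0, Rminus_diag, Rminus_0_r, Rabs_pos_eq by apply Hbounds.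
    destruct (kernel_bound_cauchy x Hx) as [Hdecay _].
    rewrite Rabs_pos_eq in Hdecay by lra. assert (Heg : e <= g) by nra. split; nra.
  - pose proof (cauchy_kernel_le_1 x).
    rewrite Rabs_pos_eq by apply Hbounds. nra.
Qed.

Lemma kernel_sums_cauchy_pow_mult (k : nat) (b : R) : 1 < b -> kernel_sums cauchy_kernel ->
  kernel_sums (fun x => cauchy_kernel x ^ k * cauchy_kernel (sqrt b * x)).
Proof.
  intros Hb Hcauchy. revert b Hb. induction k as [|k IH]; intros b Hb.
  - apply (kernel_sums_ext (fun x => cauchy_kernel (sqrt b * x))); [intros; simpl; ring|].
    apply kernel_sums_dilate; [apply sqrt_lt_R0; lra|exact Hcauchy].
  - (* partial fractions: [v w = (v - b w) / (1 - b)] for [v = 1 / (1 + y)], [w = 1 / (1 + b y)] *)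
    apply (kernel_sums_ext (fun x => / (1 - b) * (cauchy_kernel x ^ S k
                              - b * (cauchy_kernel x ^ k * cauchy_kernel (sqrt b * x))))).
    + intros x Hx. rewrite cauchy_kernel_dilate by lra. simpl.
      set (p := cauchy_kernel x ^ k). unfold cauchy_kernel. field. repeat split; nra.
    + apply kernel_sums_scal, kernel_sums_minus.
      * now apply kernel_sums_cauchy_pow_of_mult.
      * now apply kernel_sums_scal, IH.
Qed.

Lemma kernel_sums_cauchy_pow (k : nat) :
  kernel_sums cauchy_kernel -> kernel_sums (fun x => cauchy_kernel x ^ S k).
Proof.
  intros Hcauchy. apply kernel_sums_cauchy_pow_of_mult. intros b Hb.
  now apply kernel_sums_cauchy_pow_mult.
Qed.

Lemma kernel_sums_of_cauchy (phi : R -> R) :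
  kernel_sums cauchy_kernel -> is_kernel phi -> (forall x, 0 < x -> continuity_pt phi x) ->
  kernel_sums phi.
Proof.
  intros Hcauchy. apply (kernel_sums_of_coordinate_powers _ _ _ _ _ kernel_coordinate_cauchy).
  intros k. now apply kernel_sums_cauchy_pow.
Qed.

Lemma is_derive_kernel_sum (phi psi : R -> R) (p h : R) (N : nat) : 0 < h ->
  (forall x, 0 < x -> is_derive psi x (p * (phi x - psi x) / x)) -> psi 0 = phi 0 ->
  is_derive (fun h => sum_n (fun n => a n * psi (lam n * h)) N) h
    (p / h * (sum_n (fun n => a n * phi (lam n * h)) N - sum_n (fun n => a n * psi (lam n * h)) N)).
Proof.
  intros Hh Dpsi E0.
  assert (Dterm : forall n, is_derive (fun h => a n * psi (lam n * h)) h
            (p / h * (a n * phi (lam n * h) - a n * psi (lam n * h)))).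
  { intros n. replace (p / h * (a n * phi (lam n * h) - a n * psi (lam n * h))) with
      (a n * (p / h * (phi (lam n * h) - psi (lam n * h)))) by ring.
    apply (is_derive_scal (fun h => psi (lam n * h))). destruct (lam_ge0 n) as [Hlam|<-].
    - assert (Hx : 0 < lam n * h) by now apply Rmult_lt_0_compat.
      replace (p / h * (phi (lam n * h) - psi (lam n * h))) with
        (lam n * (p * (phi (lam n * h) - psi (lam n * h)) / (lam n * h))) by (field; lra).
      apply (is_derive_comp psi (fun h => lam n * h)); [now apply Dpsi|].
      auto_derive; [trivial|ring].
    - rewrite Rmult_0_l, E0, Rminus_diag, Rmult_0_r.
      apply (is_derive_ext (fun _ => psi 0)); [intros t; now rewrite Rmult_0_l|].
      apply (is_derive_const (V := R_NormedModule)). }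
  induction N as [|N IH].
  - rewrite !sum_O. apply (is_derive_ext (fun h => a 0%nat * psi (lam 0%nat * h))).
    + intros t. now rewrite sum_O.
    + apply Dterm.
  - rewrite !sum_Sn. unfold plus; simpl.
    apply (is_derive_ext (fun h => sum_n (fun n => a n * psi (lam n * h)) N
                                   + a (S N) * psi (lam (S N) * h))).
    + intros t. now rewrite sum_Sn.
    + replace (p / h * _) with
        (p / h * (sum_n (fun n => a n * phi (lam n * h)) N
                  - sum_n (fun n => a n * psi (lam n * h)) N)
         + p / h * (a (S N) * phi (lam (S N) * h) - a (S N) * psi (lam (S N) * h))) by ring.
      apply (is_derive_plus (V := R_NormedModule)); [exact IH|apply Dterm].
Qed.

Lemma is_derive_Rpower (p h : R) :
  0 < h -> is_derive (fun h => Rpower h p) h (p / h * Rpower h p).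
Proof. intros Hh. unfold Rpower. auto_derive; [exact Hh|]. field. lra. Qed.

Lemma Rabs_partial_mean_minus_le (phi : R -> R) (B L eps h1 h : R) (N : nat) :
  kernel_bound B phi -> 0 < h1 <= h -> Rabs (kernel_mean phi h - L) <= eps ->
  Rabs (sum_n (fun n => a n * phi (lam n * h)) N - L) <=
  eps + B * (1 + / h1) * tail_abs_over_1_plus N.
Proof.
  intros HB Hh Heps. set (s := sum_n (fun n => a n * phi (lam n * h)) N).
  replace (s - L) with ((kernel_mean phi h - L) - (kernel_mean phi h - s)) by ring.
  eapply Rle_trans; [apply Rabs_triang|]. rewrite Rabs_Ropp.
  apply Rplus_le_compat; [exact Heps|].
  eapply Rle_trans; [apply (Rabs_kernel_mean_minus_sum_n_le phi B); [exact HB|lra]|].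
  apply Rmult_le_compat_r; [apply tail_abs_over_1_plus_ge0|].
  apply Rmult_le_compat_l; [exact (kernel_bound_ge0 _ _ HB)|].
  apply Rplus_le_compat_l, Rinv_le_contravar; lra.
Qed.

Lemma is_derive_Rpower_mult_kernel_sum (phi psi : R -> R) (p L h : R) (N : nat) : 0 < h ->
  (forall x, 0 < x -> is_derive psi x (p * (phi x - psi x) / x)) -> psi 0 = phi 0 ->
  is_derive (fun h => Rpower h p * (sum_n (fun n => a n * psi (lam n * h)) N - L)) h
    (p / h * Rpower h p * (sum_n (fun n => a n * phi (lam n * h)) N - L)).
Proof.
  intros Hh Dpsi E0.
  set (sum_phi := sum_n (fun n => a n * phi (lam n * h)) N).
  set (sum_psi := fun h => sum_n (fun n => a n * psi (lam n * h)) N).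
  replace (p / h * Rpower h p * (sum_phi - L)) with
    (p / h * Rpower h p * (sum_psi h - L)
     + Rpower h p * (p / h * (sum_phi - sum_psi h) - 0)) by ring.
  apply (is_derive_mult (K := R_AbsRing) (fun h => Rpower h p) (fun h => sum_psi h - L)).
  - now apply is_derive_Rpower.
  - apply (is_derive_minus (V := R_NormedModule) sum_psi (fun _ => L)).
    + now apply is_derive_kernel_sum.
    + apply (is_derive_const (V := R_NormedModule)).
  - intros ? ?. apply Rmult_comm.
Qed.

Lemma Rabs_partial_mean_increment_le (phi psi : R -> R) (p B L eps h1 h2 : R) (N : nat) :
  p <> 0 -> 0 < h1 <= h2 -> kernel_bound B phi -> psi 0 = phi 0 ->
  (forall x, 0 < x -> is_derive psi x (p * (phi x - psi x) / x)) ->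
  (forall h, h1 <= h <= h2 -> Rabs (kernel_mean phi h - L) <= eps) ->
  Rabs (Rpower h2 p * (sum_n (fun n => a n * psi (lam n * h2)) N - L)
        - Rpower h1 p * (sum_n (fun n => a n * psi (lam n * h1)) N - L)) <=
  (eps + B * (1 + / h1) * tail_abs_over_1_plus N) * (Rabs p / p * (Rpower h2 p - Rpower h1 p)).
Proof.
  intros Hp Hh HB E0 Dpsi Hphi.
  set (T := tail_abs_over_1_plus N).
  set (c := (eps + B * (1 + / h1) * T) * (Rabs p / p)).
  replace (_ * (Rabs p / p * _)) with (c * Rpower h2 p - c * Rpower h1 p) by (unfold c; ring).
  set (f := fun h => Rpower h p * (sum_n (fun n => a n * psi (lam n * h)) N - L)).
  set (df := fun h => p / h * Rpower h p * (sum_n (fun n => a n * phi (lam n * h)) N - L)).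
  assert (Df : forall h, 0 < h -> is_derive f h (df h)).
  { intros h Hh0. now apply is_derive_Rpower_mult_kernel_sum. }
  assert (Dpow : forall h, 0 < h ->
            is_derive (fun h => c * Rpower h p) h (c * (p / h * Rpower h p))).
  { intros h Hh0. now apply (is_derive_scal (fun h => Rpower h p)), is_derive_Rpower. }
  apply (Rabs_diff_le_of_derive f (fun h => c * Rpower h p) df
    (fun h => c * (p / h * Rpower h p))).
  - lra.
  - intros h Hh12. eapply continuity_pt_of_is_derive, Df. lra.
  - intros h Hh12. eapply continuity_pt_of_is_derive, Dpow. lra.
  - intros h Hh12. apply Df. lra.
  - intros h Hh12. apply Dpow. lra.
  - intros h Hh12. assert (Hr : 0 < Rpower h p) by apply exp_pos.
    assert (Hi : 0 < / h) by (apply Rinv_0_lt_compat; lra).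
    replace (c * (p / h * Rpower h p)) with
      (Rabs p * / h * Rpower h p * (eps + B * (1 + / h1) * T)) by (unfold c; field; lra).
    unfold df, Rdiv. rewrite !Rabs_mult, (Rabs_pos_eq (/ h)), (Rabs_pos_eq (Rpower h p)) by lra.
    apply Rmult_le_compat_l.
    { apply Rmult_le_pos; [|lra]. apply Rmult_le_pos; [apply Rabs_pos|lra]. }
    apply (Rabs_partial_mean_minus_le phi B); [exact HB|lra|now apply Hphi].
Qed.

Lemma Rabs_kernel_mean_increment_le (phi psi : R -> R) (p B L eps h1 h2 : R) :
  p <> 0 -> 0 < h1 <= h2 -> kernel_bound B phi -> is_kernel psi -> psi 0 = phi 0 ->
  (forall x, 0 < x -> is_derive psi x (p * (phi x - psi x) / x)) ->
  (forall h, h1 <= h <= h2 -> Rabs (kernel_mean phi h - L) <= eps) ->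
  Rabs (Rpower h2 p * (kernel_mean psi h2 - L) - Rpower h1 p * (kernel_mean psi h1 - L)) <=
  eps * (Rabs p / p * (Rpower h2 p - Rpower h1 p)).
Proof.
  intros Hp Hh HB Kpsi E0 Dpsi Hphi.
  set (sum_psi := fun N h => sum_n (fun n => a n * psi (lam n * h)) N).
  set (tail := fun N => B * (1 + / h1) * tail_abs_over_1_plus N).
  assert (Hpartial : forall N,
    Rabs (Rpower h2 p * (sum_psi N h2 - L) - Rpower h1 p * (sum_psi N h1 - L)) <=
    (eps + tail N) * (Rabs p / p * (Rpower h2 p - Rpower h1 p))).
  { intros N. now apply (Rabs_partial_mean_increment_le phi). }
  assert (Hlim : forall h, 0 < h -> is_lim_seq (fun N => Rpower h p * (sum_psi N h - L))
                                     (Rpower h p * (kernel_mean psi h - L))).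
  { intros h Hh0. apply (is_lim_seq_scal_l _ _ (Finite _)).
    apply is_lim_seq_minus'; [|apply is_lim_seq_const].
    exact (Series_correct _ (ex_series_kernel psi h Kpsi Hh0)). }
  assert (Htail : is_lim_seq tail 0).
  { replace 0 with (B * (1 + / h1) * 0) by ring.
    apply (is_lim_seq_scal_l _ _ (Finite _)), is_lim_seq_tail_abs_over_1_plus. }
  refine (is_lim_seq_le _ _ (Finite _) (Finite _) Hpartial _ _).
  - apply (is_lim_seq_abs _ (Finite _)), is_lim_seq_minus'; apply Hlim; lra.
  - set (c := Rabs p / p * _). replace (eps * c) with ((eps + 0) * c) by ring.
    apply (is_lim_seq_scal_r _ _ (Finite _)).
    apply is_lim_seq_plus'; [apply is_lim_seq_const|exact Htail].
Qed.

(* The mean of [psi] at [h] is the average of those of [phi] over [(0, h)] if [p > 0], and over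
   [(h, oo)] if [p < 0], with respect to [t^(p - 1) dt]. *)
Lemma kernel_sums_average (phi psi : R -> R) (p : R) :
  p < 0 \/ 1 < p -> is_kernel psi -> psi 0 = phi 0 ->
  (forall x, 0 < x -> is_derive psi x (p * (phi x - psi x) / x)) ->
  kernel_sums phi -> kernel_sums psi.
Proof.
  intros Hp Kpsi E0 Dpsi [[B HB] Lphi]. split; [exact Kpsi|]. rewrite E0.
  rewrite filterlim_at_right_0_iff in Lphi |- *. intros eps Heps.
  destruct (Lphi (eps / 2) ltac:(lra)) as (d & Hd & Hphi). set (L := phi 0 * l) in *.
  assert (Hincr : power_increments_le (kernel_mean psi) p L (eps / 2) d).
  { intros h1 h2 Hh Hhd. apply (Rabs_kernel_mean_increment_le phi psi p B); auto; [lra|].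
    intros h Hh12. left. apply Hphi. lra. }
  replace eps with (2 * (eps / 2)) by field. destruct Hp as [Hp|Hp].
  - apply (eventually_close_of_power_increments_neg _ p L (eps / 2) d); auto. lra.
  - destruct Kpsi as [B' HB'].
    apply (eventually_close_of_power_increments_pos _ p L (eps / 2) d
      (B' * series_abs_over_1_plus)); auto; [lra|].
    intros h Hh. now apply Rabs_kernel_mean_le.
Qed.

Lemma kernel_sums_riesz_succ (b : R) :
  0 < b -> kernel_sums (riesz_kernel b) -> kernel_sums (riesz_kernel (b + 1)).
Proof.
  intros Hb. apply (kernel_sums_average _ _ (- (b + 1))).
  - left. lra.
  - exists (2 + (b + 1)). apply kernel_bound_riesz. lra.
  - now rewrite !riesz_kernel_0.
  - intros x Hx. unfold riesz_kernel.
    replace (- (b + 1) * (pw (1 - x) b - pw (1 - x) (b + 1)) / x) with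
      (- 1 * ((b + 1) * pw (1 - x) (b + 1 - 1))).
    + apply (is_derive_comp (fun y => pw y (b + 1)) (fun x => 1 - x)).
      * apply is_derive_pw. right. lra.
      * auto_derive; [trivial|ring].
    + replace (b + 1 - 1) with b by ring. destruct (Rle_dec x 1) as [Hx1|Hx1].
      * rewrite (pw_pred (1 - x) (b + 1)) by lra. replace (b + 1 - 1) with b by ring.
        field. lra.
      * rewrite !pw_nonpos by lra. field. lra.
Qed.

Lemma kernel_sums_young_succ (k : R) :
  1 <= k -> kernel_sums (young k) -> kernel_sums (young (k + 1)).
Proof.
  intros Hk. apply (kernel_sums_average _ _ (k + 1)).
  - right. lra.
  - apply is_kernel_young. lra.
  - now rewrite !young_0.
  - intros x Hx. now apply is_derive_young_succ.
Qed.

Lemma kernel_sums_abel_of_riesz (b : R) :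
  0 < b -> kernel_sums (riesz_kernel b) -> kernel_sums abel_kernel.
Proof.
  intros Hb Hriesz. apply (kernel_sums_uniform_limit 1). intros eps Heps.
  destruct (exists_large_of_succ (fun k => kernel_sums (riesz_kernel k)) b
    (Rmax 1 (4 / eps))) as (c & Hc & Hbc & Hsum).
  { intros k Hk. apply kernel_sums_riesz_succ. lra. }
  { exact Hriesz. }
  pose proof (Rmax_l 1 (4 / eps)). pose proof (Rmax_r 1 (4 / eps)).
  assert (Hceps : 4 <= c * eps) by (apply Rle_div_l; lra).
  exists (fun x => riesz_kernel c (/ c * x)).
  assert (Hdiff : forall x, 0 <= x -> 0 <= abel_kernel x - riesz_kernel c (/ c * x)
                                        <= x * x * abel_kernel x / c).
  { intros x Hx. apply abel_minus_riesz_dilated; lra. }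
  split; [|split; [|split]].
  - apply kernel_sums_dilate; [apply Rinv_0_lt_compat; lra|exact Hsum].
  - now rewrite Rmult_0_r, abel_kernel_0, riesz_kernel_0.
  - intros x Hx. specialize (Hdiff x Hx). rewrite Rmult_0_r, abel_kernel_0, riesz_kernel_0.
    rewrite Rminus_diag, Rminus_0_r, Rabs_pos_eq by lra.
    pose proof (abel_kernel_le_inv x Hx) as Hdecay.
    assert (Hcx : 0 <= / c * x) by (apply Rmult_le_pos; [left; apply Rinv_0_lt_compat|]; lra).
    pose proof (riesz_kernel_bounds c (/ c * x) ltac:(lra) Hcx). split; [nra|].
    eapply Rle_trans; [apply Hdiff|]. apply Rle_div_l; [lra|].
    pose proof (exp_pos (- x) : 0 < abel_kernel x).
    assert (x * abel_kernel x <= 1) by lra. nra.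
  - intros x Hx. specialize (Hdiff x Hx). rewrite Rabs_pos_eq by lra.
    eapply Rle_trans; [apply Hdiff|]. apply Rle_div_l; [lra|].
    pose proof (sqr_mult_abel_kernel_le x Hx). lra.
Qed.

Lemma kernel_sums_cauchy_of_young (k : R) :
  1 <= k -> kernel_sums (young k) -> kernel_sums cauchy_kernel.
Proof.
  intros Hk Hyoung. apply (kernel_sums_uniform_limit (2 + 2)). intros eps Heps.
  destruct (exists_large_of_succ (fun j => kernel_sums (young j)) k (2 / eps))
    as (c & Hc & Hkc & Hsum).
  { intros j Hj. apply kernel_sums_young_succ. lra. }
  { exact Hyoung. }
  exists (fun x => young c (c * x)). split; [|split; [|split]].
  - apply kernel_sums_dilate; [lra|exact Hsum].
  - now rewrite Rmult_0_r, cauchy_kernel_0, young_0.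
  - apply kernel_bound_minus; [apply kernel_bound_cauchy|apply kernel_bound_young_dilated; lra].
  - intros x Hx. rewrite Rabs_minus_sym.
    eapply Rle_trans; [apply young_dilated_minus_cauchy_le; lra|].
    apply Rle_div_l in Hc; [|lra]. apply Rle_div_l; nra.
Qed.

Lemma kernel_sums_classical_transfer (phi psi : R -> R) :
  classical_kernel phi -> classical_kernel psi -> kernel_sums phi -> kernel_sums psi.
Proof.
  intros Hphi Hpsi Hsum.
  pose proof (is_kernel_classical psi Hpsi) as Kpsi.
  pose proof (continuity_pt_classical psi Hpsi) as Cpsi.
  destruct Hphi as [k Hk|b Hb|].
  - apply kernel_sums_of_cauchy; auto. now apply (kernel_sums_cauchy_of_young k).
  - apply kernel_sums_of_abel; auto. now apply (kernel_sums_abel_of_riesz b).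
  - now apply kernel_sums_of_abel.
Qed.

End Means.

(** * Complex series *)

Lemma filterlim_C_iff {T : Type} (F : (T -> Prop) -> Prop) {FF : Filter F} (f : T -> C) (z : C) :
  filterlim f F (locally z) <->
  filterlim (fun x => Re (f x)) F (locally (Re z)) /\
  filterlim (fun x => Im (f x)) F (locally (Im z)).
Proof.
  rewrite !filterlim_locally. split.
  - intros H. split; intros eps; generalize (H eps); apply filter_imp; intros x Hx; apply Hx.
  - intros [HRe HIm] eps. generalize (filter_and _ _ (HRe eps) (HIm eps)). apply filter_imp.
    intros x Hx. exact Hx.
Qed.

Lemma filterlim_Rinv_p_infty : filterlim Rinv (Rbar_locally p_infty) (at_right 0).
Proof.
  intros P [d Hd]. exists (/ d). intros x Hx. pose proof (cond_pos d) as Hd0.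
  assert (Hid : 0 < / d) by now apply Rinv_0_lt_compat.
  assert (Hix : 0 < / x) by (apply Rinv_0_lt_compat; lra).
  apply Hd; [|exact Hix]. change (Rabs (/ x - 0) < d).
  rewrite Rminus_0_r, Rabs_pos_eq, <- (Rinv_inv d) by lra.
  apply Rinv_lt_contravar; [apply Rmult_lt_0_compat; lra|exact Hx].
Qed.

Lemma filterlim_p_infty_iff_inv {T : Type} (f : R -> T) (G : (T -> Prop) -> Prop) :
  filterlim f (Rbar_locally p_infty) G <-> filterlim (fun h => f (/ h)) (at_right 0) G.
Proof.
  split; intros H.
  - eapply filterlim_comp; [exact filterlim_Rinv_0_right|exact H].
  - apply (filterlim_ext (fun x => f (/ / x))); [intros x; now rewrite Rinv_inv|].
    exact (filterlim_comp _ _ _ Rinv (fun h => f (/ h)) _ _ _ filterlim_Rinv_p_infty H).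
Qed.

Lemma Series_eventually_0 (u : nat -> R) (N : nat) :
  (forall n, (N < n)%nat -> u n = 0) -> Series u = sum_n u N.
Proof.
  intros H. apply is_series_unique.
  apply (is_lim_seq_ext_loc (fun _ => sum_n u N) _ (Finite _)); [|apply is_lim_seq_const].
  exists N. intros n Hn. induction Hn as [|n Hn IH]; [reflexivity|].
  rewrite sum_Sn, <- IH, H by lia. symmetry. apply Rplus_0_r.
Qed.

Section Complex.

Context (lam : nat -> R) (c : nat -> C).
Context (lam_ge0 : forall n, 0 <= lam n).
Context (lam_incr : forall n, lam n < lam (S n)).

Lemma lam_monotone (n m : nat) : (n <= m)%nat -> lam n <= lam m.
Proof.
  intros H. induction H as [|m Hm IH]; [lra|]. specialize (lam_incr m). lra.
Qed.

Lemma sum_le_R_lam (u : nat -> R) (n : nat) : sum_le_R lam u (lam n) = sum_n u n.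
Proof.
  unfold sum_le_R. rewrite (Series_eventually_0 _ n).
  - apply sum_n_ext_loc. intros k Hk. pose proof (lam_monotone k n Hk).
    destruct (Rle_dec (lam k) (lam n)); [reflexivity|lra].
  - intros k Hk. pose proof (lam_incr n). pose proof (lam_monotone (S n) k Hk).
    destruct (Rle_dec (lam k) (lam n)); [lra|reflexivity].
Qed.

Lemma sum_bound_of_sum_le_R :
  is_lim_seq lam p_infty ->
  (exists M X, forall x, X <= x ->
     Rabs (sum_le_R lam (fun n => lam n * Cmod (c n)) x) <= M * Rabs x) ->
  exists M, forall n, sum_n (fun k => (1 + lam k) * Cmod (c k)) n <= M * (1 + lam n).
Proof.
  intros Hlim (M & X & HM).
  set (D := sum_n (fun k => lam k * Cmod (c k))).
  set (D1 := sum_n (fun k => (1 + lam k) * Cmod (c k))).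
  destruct (proj2 (is_lim_seq_spec lam p_infty) Hlim (Rmax 1 X)) as [N HN].
  assert (Hlarge : forall n, (N <= n)%nat -> 1 < lam n /\ X < lam n).
  { intros n Hn. specialize (HN n Hn). pose proof (Rmax_l 1 X). pose proof (Rmax_r 1 X). lra. }
  assert (HD1 : forall n m, (n <= m)%nat -> D1 n <= D1 m).
  { intros n m Hnm. induction Hnm as [|m Hm IH]; [lra|].
    unfold D1 in *. rewrite sum_Sn. unfold plus; simpl.
    pose proof (lam_ge0 (S m)). pose proof (Cmod_ge_0 (c (S m))). nra. }
  assert (HD : forall n, (N <= n)%nat -> D1 n <= D1 N + 2 * (D n - D N)).
  { intros n Hn. induction Hn as [|m Hm IH]; [lra|].
    destruct (Hlarge (S m) ltac:(lia)). pose proof (Cmod_ge_0 (c (S m))).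
    unfold D, D1 in *. rewrite !sum_Sn. unfold plus; simpl. nra. }
  assert (HD0 : forall n, 0 <= D n).
  { intros n. unfold D. induction n as [|n IH].
    - rewrite sum_O. apply Rmult_le_pos; [apply lam_ge0|apply Cmod_ge_0].
    - rewrite sum_Sn. unfold plus; simpl.
      pose proof (lam_ge0 (S n)). pose proof (Cmod_ge_0 (c (S n))). nra. }
  exists (Rabs (D1 N) + 2 * Rabs M). intros n. fold (D1 n). pose proof (lam_ge0 n) as Hn0.
  pose proof (Rle_abs (D1 N)). pose proof (Rmult_le_pos _ _ (Rabs_pos (D1 N)) Hn0).
  pose proof (Rabs_pos M). pose proof (Rmult_le_pos _ _ (Rabs_pos M) Hn0).
  destruct (Nat.le_gt_cases N n) as [Hn|Hn]; [|specialize (HD1 n N ltac:(lia)); lra].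
  specialize (HD n Hn). specialize (HD0 N). destruct (Hlarge n Hn) as [_ HXn].
  specialize (HM (lam n) (Rlt_le _ _ HXn)). rewrite sum_le_R_lam in HM. fold (D n) in HM.
  rewrite (Rabs_pos_eq (lam n)) in HM by exact Hn0.
  pose proof (Rle_abs (D n)). pose proof (Rmult_le_compat_r _ _ _ Hn0 (Rle_abs M)). lra.
Qed.

Context (M : R).
Context (HM : forall n, sum_n (fun k => (1 + lam k) * Cmod (c k)) n <= M * (1 + lam n)).

Lemma lam_nondecreasing (n : nat) : lam n <= lam (S n).
Proof. left. apply lam_incr. Qed.

Lemma sum_bound_of_le_Cmod (a : nat -> R) : (forall n, Rabs (a n) <= Cmod (c n)) ->
  forall n, sum_n (fun k => (1 + lam k) * Rabs (a k)) n <= M * (1 + lam n).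
Proof.
  intros Ha n. eapply Rle_trans; [|apply HM]. apply sum_n_m_le. intros k.
  specialize (lam_ge0 k). apply Rmult_le_compat_l; [lra|apply Ha].
Qed.

Lemma Rabs_Im_le_Cmod (z : C) : Rabs (Im z) <= Cmod z.
Proof. eapply Rle_trans; [apply Rmax_r|apply Rmax_Cmod]. Qed.

Lemma ex_series_Cmod_over_1_plus : ex_series (fun n => Rabs (Cmod (c n)) / (1 + lam n)).
Proof.
  apply (ex_series_abs_over_1_plus lam (fun n => Cmod (c n)) lam_ge0 lam_nondecreasing M).
  apply sum_bound_of_le_Cmod. intros n. rewrite Rabs_pos_eq; [lra|apply Cmod_ge_0].
Qed.

Lemma ex_series_of_Cmod_le (u : nat -> C) (K : R) :
  (forall n, Cmod (u n) <= K * (Cmod (c n) / (1 + lam n))) -> ex_series u.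
Proof.
  intros H. apply (ex_series_le (V := C_CompleteNormedModule) u
    (fun n => K * (Rabs (Cmod (c n)) / (1 + lam n)))).
  - intros n. rewrite Rabs_pos_eq by apply Cmod_ge_0. apply H.
  - apply (ex_series_scal (K := R_AbsRing) (V := R_NormedModule) K
      (fun n => Rabs (Cmod (c n)) / (1 + lam n))), ex_series_Cmod_over_1_plus.
Qed.

Definition C_kernel_mean (phi : R -> R) (h : R) : C :=
  CSeries (fun n => (c n * RtoC (phi (lam n * h)%R))%C).

Definition C_kernel_sums (phi : R -> R) (l : C) : Prop :=
  kernel_sums lam (fun n => Re (c n)) (Re l) phi /\
  kernel_sums lam (fun n => Im (c n)) (Im l) phi.

Lemma ex_series_C_kernel (phi : R -> R) (h : R) :
  is_kernel phi -> 0 < h -> ex_series (fun n => (c n * RtoC (phi (lam n * h)%R))%C).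
Proof.
  intros [B HB] Hh. apply (ex_series_of_Cmod_le _ (B * (1 + / h))). intros n.
  rewrite Cmod_mult, Cmod_R, <- (Rabs_pos_eq (Cmod (c n))) by apply Cmod_ge_0.
  rewrite <- Rabs_mult. now apply (kernel_term_le lam (fun n => Cmod (c n))).
Qed.

Lemma C_kernel_sums_iff (phi : R -> R) (l : C) :
  is_kernel phi -> phi 0 = 1 ->
  (C_kernel_sums phi l <-> filterlim (C_kernel_mean phi) (at_right 0) (locally l)).
Proof.
  intros Kphi E0. unfold C_kernel_sums, kernel_sums.
  rewrite E0, !Rmult_1_l, (filterlim_C_iff (at_right 0)).
  assert (ERe : forall h, Re (C_kernel_mean phi h) = kernel_mean lam (fun n => Re (c n)) phi h).
  { intros h. apply Series_ext. intros n. destruct (c n). simpl. ring. }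
  assert (EIm : forall h, Im (C_kernel_mean phi h) = kernel_mean lam (fun n => Im (c n)) phi h).
  { intros h. apply Series_ext. intros n. destruct (c n). simpl. ring. }
  split.
  - intros [[_ HRe] [_ HIm]].
    split; [exact (filterlim_ext _ _ (fun h => eq_sym (ERe h)) HRe)
           |exact (filterlim_ext _ _ (fun h => eq_sym (EIm h)) HIm)].
  - intros [HRe HIm].
    split; (split; [exact Kphi|]);
      [exact (filterlim_ext _ _ ERe HRe)|exact (filterlim_ext _ _ EIm HIm)].
Qed.

Lemma C_kernel_sums_transfer (phi psi : R -> R) (l : C) :
  classical_kernel phi -> classical_kernel psi -> C_kernel_sums phi l -> C_kernel_sums psi l.
Proof.
  intros Hphi Hpsi [HRe HIm].
  pose proof (sum_bound_of_le_Cmod (fun n => Re (c n)) (fun n => re_le_Cmod (c n))) as MRe.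
  pose proof (sum_bound_of_le_Cmod (fun n => Im (c n)) (fun n => Rabs_Im_le_Cmod (c n))) as MIm.
  split.
  - now apply (kernel_sums_classical_transfer lam _ _ lam_ge0 lam_nondecreasing M MRe phi).
  - now apply (kernel_sums_classical_transfer lam _ _ lam_ge0 lam_nondecreasing M MIm phi).
Qed.

Lemma gamma_summable_iff (k : R) (l : C) : 1 <= k ->
  (gamma_summable lam c k l <-> C_kernel_sums (young k) l).
Proof.
  intros Hk. pose proof (is_kernel_young k Hk) as K.
  rewrite (C_kernel_sums_iff _ l K (young_0 k)). split; [intros [_ H]; exact H|].
  intros H. split; [|exact H]. exists 1. split; [lra|]. intros h Hh.
  now apply (ex_series_C_kernel (young k)).
Qed.

Lemma Abel_summable_iff (l : C) : Abel_summable lam c l <-> C_kernel_sums abel_kernel l.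
Proof.
  pose proof (is_kernel_classical _ abel_classical) as K.
  rewrite (C_kernel_sums_iff _ l K abel_kernel_0). split; [intros [_ H]; exact H|].
  intros H. split; [|exact H]. intros y Hy. now apply (ex_series_C_kernel abel_kernel).
Qed.

Lemma sum_le_riesz (b h : R) : 0 < b -> 0 < h ->
  sum_le lam (fun n => (c n * RtoC (pw (1 - lam n / / h) b))%C) (/ h) =
  C_kernel_mean (riesz_kernel b) h.
Proof.
  intros Hb Hh. unfold sum_le, C_kernel_mean, riesz_kernel.
  assert (Eterm : forall n, (if Rle_dec (lam n) (/ h)
                             then (c n * RtoC (pw (1 - lam n / / h) b))%C else RtoC 0) =
                            (c n * RtoC (pw (1 - lam n * h) b))%C).
  { intros n. unfold Rdiv. rewrite Rinv_inv.
    destruct (Rle_dec (lam n) (/ h)) as [|Hn]; [reflexivity|].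
    assert (Hlh : 1 < lam n * h) by (apply Rlt_div_l; [exact Hh|unfold Rdiv; lra]).
    rewrite pw_nonpos by lra. symmetry. apply Cmult_0_r. }
  unfold CSeries. f_equal; apply Series_ext; intros n; now rewrite Eterm.
Qed.

Lemma Riesz_summable_iff (b : R) (l : C) : 0 < b ->
  (Riesz_summable lam c b l <-> C_kernel_sums (riesz_kernel b) l).
Proof.
  intros Hb. pose proof (is_kernel_classical _ (riesz_classical b Hb)) as K.
  rewrite (C_kernel_sums_iff _ l K (riesz_kernel_0 b)). unfold Riesz_summable.
  rewrite filterlim_p_infty_iff_inv.
  assert (E : at_right 0 (fun h =>
    sum_le lam (fun n => (c n * RtoC (pw (1 - lam n / / h) b))%C) (/ h) =
    C_kernel_mean (riesz_kernel b) h)).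
  { apply (filter_imp (fun h => 0 < h)); [|exact at_right_0_pos].
    intros h Hh. now apply sum_le_riesz. }
  split; apply filterlim_ext_loc; [exact E|].
  apply (filter_imp _ _ (fun h Eh => eq_sym Eh) E).
Qed.

Lemma Cmod_cexpi (t : R) : Cmod (cexpi t) = 1.
Proof.
  unfold Cmod, cexpi. simpl fst. simpl snd. rewrite <- sqrt_1. f_equal.
  pose proof (sin2_cos2 t) as E. unfold Rsqr in E. lra.
Qed.

Lemma lam_pos_lower_bound : exists r, 0 < r /\ forall n, 0 < lam n -> r <= lam n.
Proof.
  destruct (lam_ge0 0%nat) as [H0|H0].
  - exists (lam 0%nat). split; [exact H0|]. intros n _. apply lam_monotone. lia.
  - exists (lam 1%nat). split; [rewrite H0; apply lam_incr|].
    intros [|n] Hn; [lra|]. apply lam_monotone. lia.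
Qed.

Lemma ex_series_cexpi_over (h : R) : 0 < Rabs h ->
  ex_series (fun n => if Rlt_dec 0 (lam n)
                      then (c n * cexpi (lam n * h) / RtoC (lam n * h))%C
                      else RtoC 0).
Proof.
  intros Hh. destruct lam_pos_lower_bound as (r & Hr & Hlam).
  assert (Hir : 0 < / r) by now apply Rinv_0_lt_compat.
  apply (ex_series_of_Cmod_le _ ((1 + / r) / Rabs h)). intros n.
  pose proof (lam_ge0 n). pose proof (Cmod_ge_0 (c n)).
  destruct (Rlt_dec 0 (lam n)) as [Hn|Hn].
  - assert (Hlh : lam n * h <> 0).
    { apply Rmult_integral_contrapositive_currified; [lra|].
      intros ->. rewrite Rabs_R0 in Hh. lra. }
    rewrite Cmod_div by (intros E; apply Hlh; now apply RtoC_inj).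
    rewrite Cmod_mult, Cmod_cexpi, Cmod_R, Rabs_mult, (Rabs_pos_eq (lam n)) by lra.
    replace ((1 + / r) / Rabs h * (Cmod (c n) / (1 + lam n))) with
      (Cmod (c n) / Rabs h * ((1 + / r) / (1 + lam n))) by (field; lra).
    replace (Cmod (c n) * 1 / (lam n * Rabs h)) with (Cmod (c n) / Rabs h * / lam n)
      by (field; lra).
    apply Rmult_le_compat_l; [apply Rdiv_le_0_compat; lra|].
    apply -> Rle_div_r; [|lra]. rewrite Rmult_plus_distr_l, Rinv_l, Rmult_1_r by lra.
    pose proof (Rinv_le_contravar r (lam n) Hr (Hlam n Hn)). lra.
  - rewrite Cmod_0. apply Rmult_le_pos; apply Rdiv_le_0_compat; lra.
Qed.

Lemma L_summable_iff (l : C) : L_summable lam c l <-> C_kernel_sums (young 1) l.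
Proof.
  rewrite <- (gamma_summable_iff 1 l) by lra. split; [intros [H _]; exact H|].
  intros H. split; [exact H|]. exists 1. split; [lra|]. intros h Hh.
  apply ex_series_cexpi_over. lra.
Qed.

End Complex.

Theorem theorem3p1 (lam : nat -> R) (c : nat -> C) (l : C) :
  (forall n, 0 <= lam n) ->
  (forall n, lam n < lam (S n)) ->
  is_lim_seq lam p_infty ->
  (exists M X, forall x, X <= x ->
     Rabs (sum_le_R lam (fun n => lam n * Cmod (c n)) x) <= M * Rabs x) ->
  (L_summable lam c l <-> exists kappa, 1 <= kappa /\ gamma_summable lam c kappa l) /\
  (L_summable lam c l <-> forall kappa, 1 <= kappa -> gamma_summable lam c kappa l) /\
  (L_summable lam c l <-> exists beta, 0 < beta /\ Riesz_summable lam c beta l) /\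
  (L_summable lam c l <-> forall beta, 0 < beta -> Riesz_summable lam c beta l) /\
  (L_summable lam c l <-> Abel_summable lam c l).
Proof.
  intros Hge0 Hincr Hlim Hbound.
  destruct (sum_bound_of_sum_le_R lam c Hge0 Hincr Hlim Hbound) as [M HM].
  assert (HL : forall phi, classical_kernel phi ->
            (L_summable lam c l <-> C_kernel_sums lam c phi l)).
  { intros phi Hphi. rewrite (L_summable_iff lam c Hge0 Hincr M HM).
    pose proof (young_classical 1 (Rle_refl 1)).
    split; now apply (C_kernel_sums_transfer lam c Hge0 Hincr M HM). }
  assert (Hgamma : forall k, 1 <= k -> (L_summable lam c l <-> gamma_summable lam c k l)).
  { intros k Hk. rewrite (gamma_summable_iff lam c Hge0 Hincr M HM) by exact Hk.
    now apply HL, young_classical. }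
  assert (Hriesz : forall b, 0 < b -> (L_summable lam c l <-> Riesz_summable lam c b l)).
  { intros b Hb. rewrite (Riesz_summable_iff lam c b l Hb). now apply HL, riesz_classical. }
  pose proof Rle_refl 1. pose proof Rlt_0_1.
  split; [|split; [|split; [|split]]].
  - split; [intros H1; exists 1; now rewrite <- Hgamma|intros (k & Hk & H1); now apply (Hgamma k)].
  - split; [intros H1 k Hk; now apply Hgamma|intros H1; apply (Hgamma 1); auto].
  - split; [intros H1; exists 1; now rewrite <- Hriesz|intros (b & Hb & H1); now apply (Hriesz b)].
  - split; [intros H1 b Hb; now apply Hriesz|intros H1; apply (Hriesz 1); auto].
  - rewrite (Abel_summable_iff lam c Hge0 Hincr M HM). exact (HL _ abel_classical).
Qed.
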